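(* Let $T$ be NIP with monster model $\mathbb{M}$ and let $x$ be a tuple of variables of fixed sort. Consider the hyperdefinable set $\widetilde{\mathcal{M}}_x := X_x/E_x$. For a generically stable measure $\mu \in \mathfrak{M}_{x}(\mathbb{M})$, consider the hyperimaginary $[\mu] := \bar{a}^{\mu}/E_x \in \widetilde{\mathcal{M}}_x$. Then the map $\mu \mapsto [\mu]$ is a bijection from the space of global generically stable measures (in variable $x$) to $\widetilde{\mathcal{M}}_x$ (with the inverse $\bar{a}/E_x \mapsto \mu_{\bar{a}}$).
   Context: $\mathfrak{M}_x(\mathbb{M})$ is the set of global Keisler measures in $x$ (finitely additive probability measures on definable-with-parameters subsets of $\mathbb{M}^x$). For $\bar{a}=(a_1,\dots,a_n)$, $\mathrm{Av}(\bar{a};\varphi(x,b)):=\frac1n|\{i:\models\varphi(a_i,b)\}|$. $\bar{a}$ is an $\varepsilon$-approximation for $\mu$ on $\varphi(x,y)$ if $|\mathrm{Av}(\bar{a};\varphi(x,b))-\mu(\varphi(x,b))|\le\varepsilon$ for all $b\in\mathbb{M}^y$. In an NIP theory $\mu$ is generically stable iff for some small model it is definable and finitely satisfiable over it, equivalently iff for every $\varphi(x,y)\in L$ and $\varepsilon>0$ there is an $\varepsilon$-approximation for $\mu$ on $\varphi$; moreover there is a number $n_{\varphi,\varepsilon}$ depending only on $\varphi,\varepsilon$ so that an $\varepsilon$-approximation of length exactly $n_{\varphi,\varepsilon}$ can be chosen for every generically stable $\mu$. Fix such numbers; $k$ ranges over positive integers. For a generically stable $\mu$, choose a tuple $\bar{a}^\mu=(\bar{a}^\mu_{\varphi,1/k}:\varphi(x,y)\in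 L,k\in\mathbb{N})$ with $\bar{a}^\mu_{\varphi,1/k}\in(\mathbb{M}^x)^{n_{\varphi,1/k}}$ a $1/k$-approximation for $\mu$ on $\varphi(x,y)$. $X'_x$ is the ($\emptyset$-type-definable) set of all tuples $\bar{a}=(\bar{a}_{\varphi,1/k}:\varphi\in L,k\in\mathbb{N})$, $\bar{a}_{\varphi,1/k}\in(\mathbb{M}^x)^{n_{\varphi,1/k}}$, such that for all $\varphi(x,y)\in L$, all $k$, all $k_1,k_2\ge k$ and all $b$: $|\mathrm{Av}(\bar{a}_{\varphi,1/k_1};\varphi(x,b))-\mathrm{Av}(\bar{a}_{\varphi,1/k_2};\varphi(x,b))|\le 2/k$. $X_x$ is the ($\emptyset$-type-definable) set of all $\bar{a}\in X'_x$ such that for all $\varphi_1(x,y_1),\varphi_2(x,y_2)\in L$, all $k$ and all $b_1,b_2$ with $\varphi_1(x,b_1)\wedge\varphi_2(x,b_2)$ inconsistent: $$\left|\mathrm{Av}(\bar{a}_{\varphi_1\vee\varphi_2,1/k};\varphi_1(x,b_1)\vee\varphi_2(x,b_2))-\left(\mathrm{Av}(\bar{a}_{\varphi_1,1/k};\varphi_1(x,b_1))+\mathrm{Av}(\bar{a}_{\varphi_2,1/k};\varphi_2(x,b_2))\right)\right|\le 3/k.$$ For $\bar{a}\in X_x$, $\mu_{\bar{a}}(\varphi(x,b)):=\lim_{k\to\infty}\mathrm{Av}(\bar{a}_{\varphi,1/k};\varphi(x,b))$. $E_x$ is the set of pairs $(\bar{a},\bar{a}')$ such that $|\mathrm{Av}(\bar{a}_{\varphi,1/k};\varphi(x,b))-\mathrm{Av}(\bar{a}'_{\varphi,1/k};\varphi(x,b))|\le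 4/k$ for all $\varphi(x,y)\in L$, all $k$ and all $b$; it is an $\emptyset$-type-definable equivalence relation on $X_x$. A hyperdefinable set is a quotient of a type-definable set by a type-definable equivalence relation; its elements are hyperimaginaries. *)

(* Defs.v *)
From mathcomp Require Import all_boot all_order all_algebra.
From mathcomp Require Import boolp classical_sets functions cardinality reals.
From mathcomp Require Import topology normedtype sequences.

Set Implicit Arguments.
Unset Strict Implicit.
Unset Printing Implicit Defensive.

Import Order.TTheory GRing.Theory Num.Theory.
Import numFieldNormedType.Exports.

Local Open Scope classical_set_scope.
Local Open Scope ring_scope.

(** * Many-sorted first-order logic *)

Record signature := Signature {
  srt : Type;
  fsym : Type;
  rsym : Type;
  fdom : fsym -> seq srt;
  fcod : fsym -> srt;
  rdom : rsym -> seq srt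
}.

(* A context assigns to each sort the type of variables of that sort; it may be
   infinite. *)
Definition ctx (L : signature) := srt L -> Type.

(* A finite tuple of variables is given by the list [y] of its sorts; [vars y s]
   is the type of the positions of [y] whose sort is [s]. *)
Fixpoint vars (L : signature) (y : seq (srt L)) : ctx L := fun s =>
  match y with
  | [::] => void
  | t :: y' => ((t = s) + vars y' s)%type
  end.

(* Concatenation of two (disjoint) tuples of variables. *)
Definition cjoin (L : signature) (V W : ctx L) : ctx L := fun s => (V s + W s)%type.

Section Syntax.
Variable L : signature.

Inductive term (V : ctx L) : srt L -> Type :=
| Tvar s : V s -> term V s
| Tapp (f : fsym L) : (forall s, vars (fdom f) s -> term V s) -> term V (fcod f).

(* [Fex] binds one variable of sort [t]. *)
Inductive formula (V : ctx L) : Type :=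
| Fbot
| Feq s of term V s & term V s
| Frel (r : rsym L) of forall s, vars (rdom r) s -> term V s
| Fnot of formula V
| For of formula V & formula V
| Fex t of formula (cjoin V (vars [:: t])).

Definition renaming (V W : ctx L) := forall s, V s -> W s.

Fixpoint trename V W (r : renaming V W) s (t : term V s) : term W s :=
  match t with
  | Tvar s v => Tvar (r s v)
  | Tapp f u => Tapp (fun s i => trename r (u s i))
  end.

Definition rjoin V1 V2 W1 W2 (r1 : renaming V1 W1) (r2 : renaming V2 W2) :
    renaming (cjoin V1 V2) (cjoin W1 W2) := fun s v =>
  match v with inl v1 => inl (r1 s v1) | inr v2 => inr (r2 s v2) end.

Fixpoint frename V W (r : renaming V W) (phi : formula V) : formula W :=
  match phi with
  | Fbot => Fbot W
  | Feq s t u => Feq (trename r t) (trename r u)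
  | Frel q u => @Frel W q (fun s i => trename r (u s i))
  | Fnot p => Fnot (frename r p)
  | For p q => For (frename r p) (frename r q)
  | Fex t p => Fex (frename (rjoin r (fun _ v => v)) p)
  end.

Fixpoint vlshift (y1 y2 : seq (srt L)) s : vars y1 s -> vars (y1 ++ y2) s :=
  match y1 with
  | [::] => fun v => match v with end
  | t :: y => fun v =>
      match v with inl e => inl e | inr w => inr (vlshift y2 w) end
  end.

Fixpoint vrshift (y1 y2 : seq (srt L)) s : vars y2 s -> vars (y1 ++ y2) s :=
  match y1 with
  | [::] => fun v => v
  | t :: y => fun v => inr (vrshift y v)
  end.

Fixpoint vsplit (y1 y2 : seq (srt L)) s :
    vars (y1 ++ y2) s -> vars y1 s + vars y2 s :=
  match y1 with
  | [::] => fun v => inr v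
  | t :: y => fun v =>
      match v with
      | inl e => inl (inl e)
      | inr w =>
          match vsplit w with inl w1 => inl (inr w1) | inr w2 => inr w2 end
      end
  end.

(* The L-formulas phi(x, y), with [x] fixed and [y] an arbitrary finite tuple. *)
Record pformula (x : seq (srt L)) := PFormula {
  pvars : seq (srt L);
  pform : formula (cjoin (vars x) (vars pvars))
}.

(* (phi1 \/ phi2)(x, y1 y2): the parameter variables are kept apart. *)
Definition pdisj x (phi1 phi2 : pformula x) : pformula x :=
  @PFormula x (pvars phi1 ++ pvars phi2)
    (For (frename (rjoin (fun _ v => v) (fun s v => @vlshift _ (pvars phi2) s v))
            (pform phi1))
         (frename (rjoin (fun _ v => v) (fun s v => @vrshift (pvars phi1) _ s v))
            (pform phi2))).

Definition sentence := formula (vars [::]).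

Definition theory := set sentence.

End Syntax.

Section Semantics.
Variable L : signature.

(* [vtuple C V] is the set of V-tuples of a family [C] of carriers; in particular
   [vtuple C (vars x)] is C^x. *)
Definition vtuple (C : srt L -> Type) (V : ctx L) := forall s, V s -> C s.

Definition vjoin C V W (a : vtuple C V) (b : vtuple C W) : vtuple C (cjoin V W) :=
  fun s v => match v with inl v1 => a s v1 | inr v2 => b s v2 end.

Definition vcat C y1 y2 (b1 : vtuple C (vars y1)) (b2 : vtuple C (vars y2)) :
    vtuple C (vars (y1 ++ y2)) := fun s v =>
  match vsplit v with inl v1 => b1 s v1 | inr v2 => b2 s v2 end.

Definition vnil C : vtuple C (vars [::]) := fun s v => match v with end.

Definition vmap C D V (f : forall s, C s -> D s) (a : vtuple C V) : vtuple D V :=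
  fun s v => f s (a s v).

Record structure := Structure {
  carrier :> srt L -> Type;
  carrier_inh : forall s, inhabited (carrier s);
  finterp : forall f : fsym L, vtuple carrier (vars (fdom f)) -> carrier (fcod f);
  rinterp : forall r : rsym L, vtuple carrier (vars (rdom r)) -> Prop
}.

Variable M : structure.

Fixpoint teval V (a : vtuple M V) s (t : term V s) : M s :=
  match t with
  | Tvar s v => a s v
  | Tapp f u => finterp (fun s i => teval a (u s i))
  end.

Fixpoint sat V (a : vtuple M V) (phi : formula V) : Prop :=
  match phi with
  | Fbot => False
  | Feq s t u => teval a t = teval a u
  | Frel r u => @rinterp M r (fun s i => teval a (u s i))
  | Fnot p => ~ sat a p
  | For p q => sat a p \/ sat a q
  | Fex t p => exists c : vtuple M (vars [:: t]), sat (vjoin a c) p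
  end.

Definition models (T : theory L) :=
  forall sigma, T sigma -> sat (vnil M) sigma.

(* The solution sets of partial types with parameters from the tuple [p]. *)
Definition type_definable V P (p : vtuple M P) (D : set (vtuple M V)) :=
  exists Sigma : set (formula (cjoin V P)),
    D = [set a | forall sigma, Sigma sigma -> sat (vjoin a p) sigma].

(* [X] and [E] are type-definable without parameters, and [E] restricts to an
   equivalence relation on [X]. *)
Definition hyperdefinable V (X : set (vtuple M V)) (E : vtuple M V -> vtuple M V -> Prop) :=
  [/\ type_definable (vnil M) X,
      type_definable (vnil M)
        [set c : vtuple M (cjoin V V) |
           E (fun s v => c s (inl v)) (fun s v => c s (inr v))]
    & [/\ forall a, X a -> E a a,
          forall a b, X a -> X b -> E a b -> E b a
        & forall a b c, X a -> X b -> X c -> E a b -> E b c -> E a c]].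

Definition hclass V (X : set (vtuple M V)) (E : vtuple M V -> vtuple M V -> Prop)
    (a : vtuple M V) : set (vtuple M V) := [set b | X b /\ E a b].

Definition hquotient V (X : set (vtuple M V)) (E : vtuple M V -> vtuple M V -> Prop) :
  set (set (vtuple M V)) := [set hclass X E a | a in X].

Definition automorphism (f : forall s, M s -> M s) :=
  [/\ forall s, bijective (f s),
      forall (g : fsym L) (a : vtuple M (vars (fdom g))),
        f _ (finterp a) = finterp (vmap f a)
    & forall (r : rsym L) (a : vtuple M (vars (rdom r))),
        rinterp a <-> rinterp (vmap f a)].

End Semantics.

(** * Theories and monster models *)

Section Monster.
Variable L : signature.

(* Consistency is not included: it is only used for theories with a model. *)
Definition complete_theory (T : theory L) :=
  forall sigma : sentence L,
    (forall N : structure L, models N T -> sat (vnil N) sigma) \/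
    (forall N : structure L, models N T -> sat (vnil N) (Fnot sigma)).

(* No formula shatters an infinite set in a model of [T]. *)
Definition NIP (T : theory L) :=
  forall N : structure L, models N T ->
  forall (x y : seq (srt L)) (phi : formula (cjoin (vars x) (vars y))),
  ~ exists (a : nat -> vtuple N (vars x)) (b : set nat -> vtuple N (vars y)),
      forall i I, sat (vjoin (a i) (b I)) phi <-> I i.

(* The cardinal kappa is represented by a type [K] of that cardinality. *)
Definition card_small (K A : Type) := ~~ ([set: K] #<= [set: A])%card.

Definition ctx_small (K : Type) (V : ctx L) := card_small K {s & V s}.

Definition saturated (K : Type) (M : structure L) :=
  forall (P : ctx L) (p : vtuple M P) (y : seq (srt L))
         (Sigma : set (formula (cjoin (vars y) P))),
    ctx_small K P ->
    (forall F, finite_set F -> F `<=` Sigma ->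
       exists a, forall sigma, F sigma -> sat (vjoin a p) sigma) ->
    exists a, forall sigma, Sigma sigma -> sat (vjoin a p) sigma.

Definition strongly_homogeneous (K : Type) (M : structure L) :=
  forall (P : ctx L) (p q : vtuple M P),
    ctx_small K P ->
    (forall phi : formula P, sat p phi <-> sat q phi) ->
    exists2 f : forall s, M s -> M s, automorphism f & vmap f p = q.

Definition monster (K : Type) (T : theory L) (M : structure L) :=
  [/\ models M T,
      card_small K nat /\ card_small K (srt L + fsym L + rsym L)%type,
      saturated K M
    & strongly_homogeneous K M].

(* Submodels of [M] are given by elementary embeddings into [M]. *)
Definition elementary (N M : structure L) (i : vtuple M N) :=
  forall (y : seq (srt L)) (phi : formula (vars y)) (a : vtuple N (vars y)),
    sat a phi <-> sat (vmap i a) phi.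

End Monster.

(** * Keisler measures *)

Section Keisler.
Variables (R : realType) (L : signature) (M : structure L) (x : seq (srt L)).

(* phi(M, b) *)
Definition pset (phi : pformula x) (b : vtuple M (vars (pvars phi))) :
  set (vtuple M (vars x)) := [set a | sat (vjoin a b) (pform phi)].
Arguments pset : clear implicits.

Definition definable (D : set (vtuple M (vars x))) :=
  exists (phi : pformula x) (b : vtuple M (vars (pvars phi))), D = pset phi b.

Definition defset := {D : set (vtuple M (vars x)) | definable D}.

Definition inst (phi : pformula x) (b : vtuple M (vars (pvars phi))) : defset :=
  exist definable (pset phi b) (ex_intro _ phi (ex_intro _ b erefl)).
Arguments inst : clear implicits.

(* The library's contents are defined on all sets, so that equality of two of
   them is finer than agreement on definable sets; hence the following type. *)
Record keisler := Keisler {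
  meas :> defset -> R;
  meas_ge0 : forall D, 0 <= meas D;
  meas_setT : forall D, sval D = setT -> meas D = 1;
  meas_additive : forall D1 D2 D, sval D1 `&` sval D2 = set0 ->
    sval D = sval D1 `|` sval D2 -> meas D = meas D1 + meas D2
}.

Definition Av n (a : 'I_n -> vtuple M (vars x)) (phi : pformula x)
    (b : vtuple M (vars (pvars phi))) : R :=
  #|[set i | `[< pset phi b (a i) >]]%SET|%:R / n%:R.
Arguments Av {n} a phi b.

Definition approximation (eps : R) (mu : keisler) (phi : pformula x) n
    (a : 'I_n -> vtuple M (vars x)) :=
  forall b : vtuple M (vars (pvars phi)), `|Av a phi b - mu (inst phi b)| <= eps.

(* For every closed C, the set {b | mu(phi(x, b)) in C} is type-definable over
   the submodel. *)
Definition definable_over (N : structure L) (i : vtuple M N) (mu : keisler) :=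
  forall (phi : pformula x) (C : set R), closed C ->
    type_definable i [set b : vtuple M (vars (pvars phi)) | C (mu (inst phi b))].

Definition finitely_satisfiable_over (N : structure L) (i : vtuple M N)
    (mu : keisler) :=
  forall (phi : pformula x) (b : vtuple M (vars (pvars phi))),
    0 < mu (inst phi b) -> exists a : vtuple N (vars x), pset phi b (vmap i a).

Definition generically_stable (K : Type) (mu : keisler) :=
  exists (N : structure L) (i : vtuple M N),
    [/\ ctx_small K N, elementary i, definable_over i mu
      & finitely_satisfiable_over i mu].

End Keisler.

Arguments pset {L M x} phi b.
Arguments inst {L M x} phi b.
Arguments Av R {L M x n} a phi b.
Arguments approximation {R L M x} eps mu phi {n} a.

(** * The hyperdefinable set of generically stable measures *)

(* A positive integer k is represented by its predecessor: the index [k] stands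
   for 1/(k+1). *)
Definition inv_nat (R : realType) (k : nat) : R := k.+1%:R^-1.

Section Space.
Variables (R : realType) (L : signature) (M : structure L) (x : seq (srt L)).
Variable n : pformula x -> nat -> nat.

(* The variables of a tuple (a_{phi,1/k})_{phi,k} of n_{phi,1/k}-tuples of
   x-tuples. *)
Definition big_ctx : ctx L := fun s =>
  {phi : pformula x & {k : nat & ('I_(n phi k) * vars x s)%type}}.

Definition bigtuple := vtuple M big_ctx.

Definition coord (a : bigtuple) (phi : pformula x) (k : nat) :
    'I_(n phi k) -> vtuple M (vars x) :=
  fun i s v => a s (existT _ phi (existT _ k (i, v))).

Definition AvX (a : bigtuple) (phi : pformula x) (k : nat)
  (b : vtuple M (vars (pvars phi))) : R := Av R (@coord a phi k) phi b.
Arguments AvX a phi k b : clear implicits.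

Definition Xset' : set bigtuple := [set a |
  forall (phi : pformula x) (k k1 k2 : nat), (k <= k1)%N -> (k <= k2)%N ->
  forall b : vtuple M (vars (pvars phi)),
    `|AvX a phi k1 b - AvX a phi k2 b| <= 2 * inv_nat R k].

Definition Xset : set bigtuple := [set a | Xset' a /\
  forall (phi1 phi2 : pformula x) (k : nat)
         (b1 : vtuple M (vars (pvars phi1))) (b2 : vtuple M (vars (pvars phi2))),
    pset phi1 b1 `&` pset phi2 b2 = set0 ->
    `|AvX a (pdisj phi1 phi2) k (vcat b1 b2)
      - (AvX a phi1 k b1 + AvX a phi2 k b2)| <= 3 * inv_nat R k].

Definition Erel (a a' : bigtuple) :=
  forall (phi : pformula x) (k : nat) (b : vtuple M (vars (pvars phi))),
    `|AvX a phi k b - AvX a' phi k b| <= 4 * inv_nat R k.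

(* [nu] is the measure mu_a. *)
Definition limit_measure (a : bigtuple) (nu : keisler R M x) :=
  forall (phi : pformula x) (b : vtuple M (vars (pvars phi))),
    (fun k => AvX a phi k b) @ \oo --> nu (inst phi b).

(* [a] is a possible choice of the tuple a^mu. *)
Definition approximating (a : bigtuple) (mu : keisler R M x) :=
  forall (phi : pformula x) (k : nat),
    approximation (inv_nat R k) mu phi (@coord a phi k).

End Space.

Arguments Xset R {L M x n}.
Arguments Erel R {L M x n}.

(* Main.v *)
Require Import Defs.
From mathcomp Require Import all_boot all_order all_algebra.
From mathcomp Require Import boolp classical_sets functions cardinality reals.
From mathcomp Require Import topology normedtype sequences.
From mathcomp Require Import lra.

(** A point [a] of the space [X] carries its measure as a limit: the averages of
    its phi-parts along 1/k are Cauchy with a rate that does not depend on the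
    parameters, so [mu_a(phi(x, b))] exists and is within 2/k of the k-th
    average. That this number depends only on the definable set, and is additive,
    comes from the single compatibility condition on disjunctions. If phi1(x, b1)
    and phi2(x, b2) define the same set, adjoin to each of them the complement of
    that set, presented by one and the same formula: both disjunctions define the
    whole space, whose average is always 1, so both formulas have limit 1 minus
    the limit of the complement ([is_limit_unique], [limit_measure_exists]).

    The measure [mu_a] is generically stable for a direct reason. Take a small
    elementary submodel N containing all the coordinates of [a]. A set of positive
    measure has a positive average, hence contains a coordinate of [a]
    ([limit_finitely_satisfiable]). For a closed C, the condition
    mu_a(phi(x, b)) in C says that for every k the k-th average at b is within 2/k
    of C; an average is a function of the finitely many truth values of
    phi(a_i, b), so each of these conditions is one formula over N
    ([limit_definable]).

    The submodel comes from the downward Loewenheim-Skolem theorem. Its size, like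
    the number of coordinates of [a], is bounded by any infinite cardinal that
    bounds the language; the coding of terms, formulas and Skolem terms behind
    this bound takes place in one infinite type A, with an injection of A * A into
    A to form pairs, that is with Hessenberg's theorem [embeds_square].

    The rest is comparison of rates. Two E-equivalent points have averages at most
    4/k apart, hence the same limit; two points of [X] with the same limit have
    averages at most 2/k + 2/k apart, hence are E-equivalent. So E is, on [X], the
    relation of having the same limit measure, and the map from classes to measures
    is well defined and injective. A tuple approximating [mu] lies in [X] and has
    limit [mu] by additivity of [mu] and the triangle inequality, so every
    generically stable measure is reached. Type-definability of [X] and E is the
    same remark on averages, now with the coordinates of [a] as variables and the
    parameters b quantified universally. *)

Set Implicit Arguments.
Unset Strict Implicit.
Unset Printing Implicit Defensive.

Import Order.TTheory GRing.Theory Num.Theory.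
Import numFieldNormedType.Exports.

Local Open Scope classical_set_scope.

(** * Cardinal arithmetic *)

Definition embeds (A B : Type) := exists f : A -> B, injective f.

Lemma embeds_card_le A B : embeds A B <-> ([set: A] #<= [set: B])%card.
Proof.
split=> [[f f_inj]|/card_leP[f]].
  have [g] : $|{injfun [set: A] >-> [set: B]}|.
    by apply/injfunPex; exists f => // a b _ _; exact: f_inj.
  exact: inj_card_le.
exists (fun a => val (f (SigSub (mem_set (I : [set: A] a))))) => a b /val_inj.
by move/'inj_f => /(_ (mem_set I) (mem_set I))[].
Qed.

Lemma embeds_trans A B C : embeds A B -> embeds B C -> embeds A C.
Proof. by move=> [f fi] [g gi]; exists (g \o f); exact: inj_comp. Qed.

(** Zorn's lemma on graphs of partial injections: a maximal one is total on one
    side, since otherwise a point missed on each side could be matched. *)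
Lemma embeds_total A B : embeds A B \/ embeds B A.
Proof.
pose P (G : set (A * B)) := forall p q, G p -> G q -> (p.1 = q.1 <-> p.2 = q.2).
have [F FP F_tot|G [GP Gmax]] := @Zorn_bigcup _ P.
  move=> p q [X FX Xp] [Y FY Yq].
  by have [XY|YX] := F_tot _ _ FX FY;
    [apply: (FP _ FY) => //; exact: XY|apply: (FP _ FX) => //; exact: YX].
have [/choice[f fG]|/existsNP[a Ga]] := pselect (forall a, exists b, G (a, b)).
  by left; exists f => a a' faa'; exact: (GP _ _ (fG a) (fG a')).2.
have [/choice[f fG]|/existsNP[b Gb]] := pselect (forall b, exists a, G (a, b)).
  by right; exists f => b b' fbb'; exact: (GP _ _ (fG b) (fG b')).1.
exfalso; apply: (Gmax (G `|` [set (a, b)])).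
  split; first by move=> t Gt; left.
  by move=> /(_ (a, b) (or_intror erefl)) Gab; apply: Ga; exists b.
move=> p q [Gp|->] [Gq|->] //=; first exact: GP.
- case: p Gp => a' b' Gp /=; split=> E; [case: Ga|case: Gb]; rewrite -?E.
    by exists b'.
  by exists a'.
- case: q Gq => a' b' Gq /=; split=> E; [case: Ga|case: Gb]; rewrite ?E.
    by exists b'.
  by exists a'.
Qed.

(** Used to enlarge a given [G0] maximally; only nonempty chains are considered,
    since [G0] itself bounds the empty one. *)
Lemma Zorn_above T (P : set (set T)) (G0 : set T) : P G0 ->
  (forall F, F !=set0 -> F `<=` P -> total_on F subset ->
     P (\bigcup_(X in F) X)) ->
  exists G, [/\ P G, G0 `<=` G & forall H, P H -> G `<=` H -> H `<=` G].
Proof.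
move=> PG0 P_chain.
have [F FP F_tot|G [PG Gmax]] := @Zorn_bigcup _ (fun X => P (G0 `|` X)).
  have [[X0 FX0]|/set0P/negP/negPn/eqP->] := pselect (F !=set0); last first.
    by rewrite bigcup_set0 setU0.
  have -> : G0 `|` \bigcup_(X in F) X =
      \bigcup_(Y in [set G0 `|` X | X in F]) Y.
    apply/seteqP; split=> [t [G0t|[X FX Xt]]|t [_ [X FX <-] [G0t|Xt]]].
    - by exists (G0 `|` X0); [exists X0|left].
    - by exists (G0 `|` X); [exists X|right].
    - by left.
    - by right; exists X.
  apply: P_chain.
  - by exists (G0 `|` X0); exists X0.
  - by move=> _ [X FX <-]; exact: FP.
  - move=> _ _ [X FX <-] [Y FY <-].
    by have [XY|YX] := F_tot _ _ FX FY; [left|right]; exact: setUS.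
exists (G0 `|` G); split=> // H PH GH.
have G0H : G0 `|` H = H by apply/setUidPr => t G0t; apply: GH; left.
apply: contrapT => HG; apply: (Gmax H); last by rewrite G0H.
split; first by move=> t Gt; apply: GH; right.
by move=> HG'; apply: HG => t /HG' Gt; right.
Qed.

Section Pairing.
Variable A : Type.
Implicit Types G : set (A * A * A).

(** A graph [G] is read as a partial binary operation; its domain is read off the
    diagonal. *)
Definition pair_dom G : set A := [set a | exists c, G (a, a, c)].

Definition partial_pairing G :=
  [/\ forall p q, G p -> G q -> (p.1 = q.1 <-> p.2 = q.2),
      forall a b, pair_dom G a -> pair_dom G b -> exists c, G (a, b, c)
    & forall a b c, G (a, b, c) ->
        [/\ pair_dom G a, pair_dom G b & pair_dom G c]].

Lemma partial_pairing_nat (e : nat -> A) : injective e ->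
  partial_pairing [set (e p.1, e p.2, e (pickle p)) | p in [set: nat * nat]].
Proof.
move=> e_inj; set G := image _ _.
have Ge i j : G (e i, e j, e (pickle (i, j))) by exists (i, j).
have dom_e i : pair_dom G (e i) by exists (e (pickle (i, i))).
split.
- move=> _ _ [[i j] _ <-] [[i' j'] _ <-] /=; split=> [[/e_inj-> /e_inj->]//|].
  by move=> /e_inj/(pcan_inj pickleK)[-> ->].
- move=> _ _ [_ [[i ?] _ [<- _ _]]] [_ [[j ?] _ [<- _ _]]].
  by exists (e (pickle (i, j))).
- by move=> _ _ _ [[i j] _ [<- <- <-]].
Qed.

Lemma partial_pairing_bigcup (F : set (set (A * A * A))) :
  F `<=` partial_pairing -> total_on F subset ->
  partial_pairing (\bigcup_(X in F) X).
Proof.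
move=> FP F_tot; set U := \bigcup_(X in F) X.
have domU X a : F X -> pair_dom X a -> pair_dom U a.
  by move=> FX [c Xc]; exists c; exists X.
have common t u : U t -> U u -> exists X, [/\ F X, X t & X u].
  move=> [X FX Xt] [Y FY Yu]; have [XY|YX] := F_tot _ _ FX FY.
    by exists Y; split=> //; exact: XY.
  by exists X; split=> //; exact: YX.
split.
- by move=> p q Up Uq; have [X [/FP[XP _ _] Xp Xq]] := common _ _ Up Uq; exact: XP.
- move=> a b [c Uc] [d Ud]; have [X [FX Xc Xd]] := common _ _ Uc Ud.
  have [_ /(_ a b) Xab _] := FP _ FX.
  by have [||f Xf] := Xab; [exists c|exists d|exists f; exists X].
- move=> a b c [X FX Xabc]; have [_ _ /(_ _ _ _ Xabc)[*]] := FP _ FX.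
  by split; apply: (domU X).
Qed.

End Pairing.

(** The two summands are told apart by the images of 0 and 1. *)
Lemma embeds_sum_square A : embeds nat A -> embeds (A + A) (A * A).
Proof.
move=> [e e_inj].
exists (fun t => match t with inl a => (e 0, a) | inr a => (e 1, a) end).
by move=> [a|a] [b|b] [] // => [->|/e_inj|/e_inj|->].
Qed.

Lemma embeds_prod A A' B B' :
  embeds A A' -> embeds B B' -> embeds (A * B) (A' * B').
Proof.
move=> [f fi] [g gi]; exists (fun p => (f p.1, g p.2)).
by move=> [a b] [a' b'] [/fi /= -> /gi /= ->].
Qed.

Lemma embeds_sum A A' B B' :
  embeds A A' -> embeds B B' -> embeds (A + B) (A' + B').
Proof.
move=> [f fi] [g gi].
exists (fun t => match t with inl a => inl (f a) | inr b => inr (g b) end).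
by move=> [a|b] [a'|b'] // [] => [/fi->|/gi->].
Qed.

Lemma embeds_refl A : embeds A A.
Proof. by exists id. Qed.

Lemma sval_inj A (S : set A) : injective (fun s : {a | S a} => sval s).
Proof.
move=> [a Sa] [b Sb] /= ab.
by move: Sa Sb; rewrite ab => Sa Sb; congr exist; exact: Prop_irrelevance.
Qed.

(** Hessenberg's theorem. Take a maximal pairing on an infinite subset S. If the
    complement of S is no larger than S, the whole type embeds in S + S, hence in
    S. Otherwise the complement contains a copy of S; pairs of elements of the
    union of S and its copy that are not both in S can be sent injectively into
    the copy, which contradicts maximality. *)
Theorem embeds_square A : embeds nat A -> embeds (A * A) A.
Proof.
move=> [e e_inj].
have [F _|G [GP G0G Gmax]] := Zorn_above (partial_pairing_nat e_inj).
  exact: partial_pairing_bigcup.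
set S := pair_dom G; have [G_fun G_tot G_dom] := GP.
have Se i : S (e i) by exists (e (pickle (i, i))); apply: G0G; exists (i, i).
pose TS := {a | S a}.
have nat_TS : embeds nat TS.
  by exists (fun i => exist _ (e i) (Se i)) => i j [/e_inj].
have TS2 : embeds (TS * TS) TS.
  have /choice[f fG] (p : TS * TS) : exists c : TS, G (sval p.1, sval p.2, sval c).
    case: p => -[a Sa] [b Sb] /=; have [c Gc] := G_tot _ _ Sa Sb.
    by have [_ _ Sc] := G_dom _ _ _ Gc; exists (exist _ c Sc).
  exists f => -[a b] [a' b'] ff; have := fG (a, b); have := fG (a', b').
  rewrite ff => Gp Gq; have [_ /(_ erefl)] := G_fun _ _ Gp Gq; rewrite /=.
  by move=> [/(@sval_inj _ S)-> /(@sval_inj _ S)->].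
have TS_sum : embeds (TS + TS) TS := embeds_trans (embeds_sum_square nat_TS) TS2.
have [CS|[j j_inj]] := embeds_total {a | ~ S a} TS.
  have A_TS : embeds A TS.
    apply: embeds_trans TS_sum; apply: embeds_trans (embeds_sum (embeds_refl _) CS).
    exists (fun a => match pselect (S a) with
      | left Sa => inl (exist _ a Sa) | right Sa => inr (exist _ a Sa) end).
    by move=> a b; case: pselect => ?; case: pselect => ? // [].
  apply: embeds_trans (embeds_prod A_TS A_TS) _.
  by apply: embeds_trans TS2 _; exists sval; exact: sval_inj.
exfalso.
(* [v] identifies TS + TS with the union of S and its copy outside S. *)
pose v (t : TS + TS) : A := match t with inl s => sval s | inr s => sval (j s) end.
have v_inj : injective v.
  move=> [s|s] [t|t] /=.
  - by move/(@sval_inj _ S)->.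
  - by move=> E; case: (svalP (j t)); rewrite -E; exact: (svalP s).
  - by move=> E; case: (svalP (j s)); rewrite E; exact: (svalP t).
  - by move/(@sval_inj _ (fun a => ~ S a))/j_inj->.
have [h h_inj] : embeds ((TS + TS) * (TS + TS)) TS.
  exact: embeds_trans (embeds_prod TS_sum TS_sum) TS2.
pose new t u := ~ (S (v t) /\ S (v u)).
pose H := G `|` [set x | exists t u, new t u /\ x = (v t, v u, v (inr (h (t, u))))].
have Snr s : ~ S (v (inr s)) by exact: (svalP (j s)).
have domG a : S a -> exists s, a = v (inl s) by move=> Sa; exists (exist _ a Sa).
have Hpair t u : exists c, H (v t, v u, c).
  have [[St Su]|ntu] := pselect (S (v t) /\ S (v u)).
    by have [c Gc] := G_tot _ _ St Su; exists c; left.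
  by exists (v (inr (h (t, u)))); right; exists t, u.
have domH t : pair_dom H (v t) by exact: Hpair.
have domHv a : pair_dom H a -> exists t, a = v t.
  move=> [c [Gc|[t [u [_ [-> _ _]]]]]]; last by exists t.
  by have [s ->] := domG a (ex_intro _ c Gc); exists (inl s).
have /Gmax HG : partial_pairing H.
  split.
  - move=> [[a b] c] [[a' b'] c'] [Gp|[t [u [n1 [-> -> ->]]]]]
      [Gq|[t' [u' [n2 [-> -> ->]]]]].
    + exact: G_fun.
    + have [Sa Sb Sc] := G_dom _ _ _ Gp; split=> [[E1 E2]|/= E].
        by case: n2; rewrite -E1 -E2.
      by case: (Snr (h (t', u'))); move: Sc; rewrite E.
    + have [Sa Sb Sc] := G_dom _ _ _ Gq; split=> [[E1 E2]|/= E].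
        by case: n1; rewrite E1 E2.
      by case: (Snr (h (t, u))); move: Sc; rewrite -E.
    + by split=> [[/v_inj-> /v_inj->]|/= /(v_inj (inr _) (inr _))[/h_inj[-> ->]]].
  - by move=> _ _ /domHv[t ->] /domHv[u ->]; exact: Hpair.
  - move=> a b c [/G_dom[/domG[s ->] /domG[t ->] /domG[u ->]]|]; first by split.
    by move=> [t [u [_ [-> -> ->]]]]; split;
      [exact: (domH t)|exact: (domH u)|exact: (domH (inr _))].
have s0 : TS by exact: exist _ (e 0) (Se 0).
have [c Hc] := Hpair (inr s0) (inr s0).
have GH : G `<=` H by move=> t; left.
by have [/Snr] := G_dom _ _ _ (HG GH _ Hc).
Qed.

(** * Counting terms and formulas *)

Lemma existT_inj (J : Type) (F : J -> Type) j (a b : F j) :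
  existT F j a = existT F j b -> a = b.
Proof.
by move=> ab; have := projT2_eq ab; rewrite (Prop_irrelevance (projT1_eq ab) erefl).
Qed.

Lemma embeds_sigT A J (F : J -> Type) : embeds nat A ->
  embeds J A -> (forall j, embeds (F j) A) -> embeds {j & F j} A.
Proof.
move=> /embeds_square A2 [f f_inj] FA.
have [g g_inj] : {g : forall j, F j -> A | forall j, injective (g j)}.
  by exists (fun j => sval (cid (FA j))) => j; case: cid.
apply: embeds_trans A2.
exists (fun p => (f (tag p), g _ (tagged p))) => -[j a] [k b] /= [/f_inj jk].
by case: k / jk b => b /g_inj->.
Qed.

(** Given a pairing and distinct numerals in [A], syntax is coded in [A]: each
    constructor is a tag paired with the codes of its arguments. *)
Section Coding.
Variables (A : Type) (num : nat -> A) (pr : A -> A -> A).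
Hypotheses (num_inj : injective num)
  (pr_inj : forall a b c d, pr a b = pr c d -> a = c /\ b = d).

Fixpoint code_seq S (c : S -> A) (s : seq S) : A :=
  match s with
  | [::] => pr (num 0) (num 0)
  | a :: s' => pr (num 1) (pr (c a) (code_seq c s'))
  end.

Lemma code_seq_inj S (c : S -> A) : injective c -> injective (code_seq c).
Proof.
move=> c_inj; elim=> [|a s IHs] [|b t] //=.
- by move=> /pr_inj[/num_inj].
- by move=> /pr_inj[/num_inj].
- by move=> /pr_inj[_ /pr_inj[/c_inj-> /IHs->]].
Qed.

Variable L : signature.

Fixpoint code_args (y : seq (srt L)) : (forall s, vars y s -> A) -> A :=
  match y with
  | [::] => fun _ => num 0
  | t :: y' => fun g =>
      pr (g t (inl erefl)) (code_args (fun s v => g s (inr v)))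
  end.

Lemma code_args_inj y (g h : forall s, vars y s -> A) :
  code_args g = code_args h -> forall s v, g s v = h s v.
Proof.
elim: y g h => [|t y IHy] g h //= /pr_inj[gh0 gh] s [e|v]; first by case: s / e.
exact: (IHy _ _ gh).
Qed.

Variables (es : srt L -> A) (ef : Defs.fsym L -> A) (er : rsym L -> A).
Hypotheses (es_inj : injective es) (ef_inj : injective ef)
  (er_inj : injective er).

Fixpoint code_term (V : ctx L) (eV : {s & V s} -> A) s (t : term V s) : A :=
  match t with
  | Tvar s v => pr (num 0) (eV (existT _ s v))
  | Tapp f u =>
      pr (num 1) (pr (ef f) (code_args (fun s i => code_term eV (u s i))))
  end.

(** Stated for terms of two sorts, because a code determines the sort too and the
    sort of an application is not a variable. *)
Lemma code_term_inj (V : ctx L) (eV : {s & V s} -> A) : injective eV ->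
  forall s (t : term V s) s' (t' : term V s'),
    code_term eV t = code_term eV t' -> existT (term V) s t = existT _ s' t'.
Proof.
move=> eV_inj s; elim=> [{}s v|f u IHu] s' [{}s' v'|f' u'] /=.
- move=> /pr_inj[_ /eV_inj E].
  exact: (congr1 (fun w => existT (term V) (tag w) (Tvar (tagged w))) E).
- by move=> /pr_inj[/num_inj].
- by move=> /pr_inj[/num_inj].
move=> /pr_inj[_ /pr_inj[/ef_inj ff]]; case: f' / ff u' => u' /code_args_inj uu.
congr existT; congr Tapp; apply: functional_extensionality_dep => s''.
apply: functional_extensionality_dep => i.
exact: existT_inj (IHu _ _ _ _ (uu _ _)).
Qed.

Definition code_bind (V : ctx L) t (eV : {s & V s} -> A)
    (w : {s & cjoin V (vars [:: t]) s}) : A :=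
  match tagged w with
  | inl v => pr (num 0) (eV (existT _ (tag w) v))
  | inr _ => pr (num 1) (num 0)
  end.

Lemma code_bind_inj (V : ctx L) t (eV : {s & V s} -> A) :
  injective eV -> injective (@code_bind V t eV).
Proof.
move=> eV_inj [s [v|[e|[]]]] [s' [v'|[e'|[]]]]; rewrite /code_bind /=.
- move=> /pr_inj[_ /eV_inj E].
  exact: (congr1 (fun w => existT (cjoin V _) (tag w) (inl (tagged w))) E).
- by move=> /pr_inj[/num_inj].
- by move=> /pr_inj[/num_inj].
- by case: s / e; case: s' / e'.
Qed.

Fixpoint code_formula (V : ctx L) (p : formula V) : ({s & V s} -> A) -> A :=
  match p with
  | Fbot => fun _ => pr (num 0) (num 0)
  | Feq s t u => fun eV =>
      pr (num 1) (pr (code_term eV t) (code_term eV u))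
  | Frel r u => fun eV =>
      pr (num 2) (pr (er r) (code_args (fun s i => code_term eV (u s i))))
  | Fnot p => fun eV => pr (num 3) (code_formula p eV)
  | For p q => fun eV =>
      pr (num 4) (pr (code_formula p eV) (code_formula q eV))
  | Fex t p => fun eV =>
      pr (num 5) (pr (es t) (code_formula p (@code_bind V t eV)))
  end.

Lemma code_formula_inj (V : ctx L) (eV : {s & V s} -> A) (p q : formula V) :
  injective eV -> code_formula p eV = code_formula q eV -> p = q.
Proof.
move=> eV_inj; elim: p eV eV_inj q => {V}
  [V|V s t u|V r u|V p IHp|V p1 IH1 p2 IH2|V t p IHp] eV eV_inj
  [|s' t' u'|r' u'|p'|p1' p2'|t' p'] //=.
all: try by move=> /pr_inj[/num_inj].
all: move=> /pr_inj[_].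
- move=> /pr_inj[/(code_term_inj eV_inj) tt /(code_term_inj eV_inj) uu].
  have ss := projT1_eq tt; rewrite /= in ss.
  by case: s' / ss t' u' tt uu => t' u' tt uu;
    rewrite (existT_inj tt) (existT_inj uu).
- move=> /pr_inj[/er_inj rr]; case: r' / rr u' => u' /code_args_inj uu.
  congr Frel; apply: functional_extensionality_dep => s.
  apply: functional_extensionality_dep => i.
  exact: existT_inj (code_term_inj eV_inj (uu _ _)).
- by move=> /(IHp _ eV_inj)->.
- by move=> /pr_inj[/(IH1 _ eV_inj)-> /(IH2 _ eV_inj)->].
- move=> /pr_inj[/es_inj tt]; case: t' / tt p' => p'.
  by move=> /(IHp _ (code_bind_inj eV_inj))->.
Qed.

End Coding.

Lemma embeds_pairing A : embeds nat A ->
  exists pr : A -> A -> A, forall a b c d, pr a b = pr c d -> a = c /\ b = d.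
Proof.
by move=> /embeds_square[f f_inj]; exists (fun a b => f (a, b)) => a b c d /f_inj[].
Qed.

Lemma embeds_seq A S : embeds nat A -> embeds S A -> embeds (seq S) A.
Proof.
move=> natA [c c_inj]; have [num num_inj] := natA.
have [pr pr_inj] := embeds_pairing natA.
by exists (code_seq num pr c); exact: code_seq_inj.
Qed.

Definition lang_embeds (L : signature) A :=
  [/\ embeds (srt L) A, embeds (Defs.fsym L) A & embeds (rsym L) A].

Lemma embeds_formula L (V : ctx L) A : embeds nat A -> lang_embeds L A ->
  embeds {s & V s} A -> embeds (formula V) A.
Proof.
move=> natA [[es es_inj] [ef ef_inj] [er er_inj]] [eV eV_inj].
have [num num_inj] := natA; have [pr pr_inj] := embeds_pairing natA.
exists (fun p => code_formula num pr es ef er p eV) => p q.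
exact: code_formula_inj.
Qed.

Lemma embeds_vars L (y : seq (srt L)) : embeds {s & vars y s} nat.
Proof.
elim: y => [|t y [pos pos_inj]]; first by exists (fun=> 0) => -[s []].
exists (fun w => match tagged w with
  | inl _ => 0 | inr v => (pos (existT _ (tag w) v)).+1 end).
move=> [s [e|v]] [s' [e'|v']] //=; first by case: s / e; case: s' / e'.
move=> [] /pos_inj E.
exact: (congr1 (fun w => existT (vars (t :: y)) (tag w) (inr (tagged w))) E).
Qed.

Lemma embeds_cjoin L (V W : ctx L) A : embeds nat A ->
  embeds {s & V s} A -> embeds {s & W s} A -> embeds {s & cjoin V W s} A.
Proof.
move=> natA VA WA; apply: embeds_trans (embeds_square natA).
apply: embeds_trans (embeds_sum_square natA); apply: embeds_trans (embeds_sum VA WA).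
exists (fun w => match tagged w with
  | inl v => inl (existT _ (tag w) v) | inr v => inr (existT _ (tag w) v) end).
move=> [s [v|v]] [s' [v'|v']] //= [_ E].
  exact: (congr1 (fun w => existT (cjoin V W) (tag w) (inl (tagged w))) E).
exact: (congr1 (fun w => existT (cjoin V W) (tag w) (inr (tagged w))) E).
Qed.

Lemma embeds_pformula L (x : seq (srt L)) A :
  embeds nat A -> lang_embeds L A -> embeds (pformula x) A.
Proof.
move=> natA LA; have [sA _ _] := LA.
have varsA (y : seq (srt L)) : embeds {s & vars y s} A.
  exact: embeds_trans (embeds_vars y) natA.
apply: (@embeds_trans _ {y & formula (cjoin (vars x) (vars y))}).
  exists (fun p => existT _ (pvars p) (pform p)) => -[y p] [z q] /= E.
  exact: (congr1 (fun w => PFormula (tagged w)) E).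
apply: embeds_sigT => // [|y]; first exact: embeds_seq.
by apply: embeds_formula => //; exact: embeds_cjoin.
Qed.

(** * Renaming and the downward Loewenheim-Skolem theorem *)

Section Renaming.
Variables (L : signature) (M : structure L).

Lemma teval_trename (V W : ctx L) (r : renaming V W) (a : vtuple M W) s
    (t : term V s) :
  teval a (trename r t) = teval (fun s v => a s (r s v)) t.
Proof.
elim: t => [//|f u IHu] /=; congr finterp.
apply: functional_extensionality_dep => s'.
by apply: functional_extensionality_dep => i.
Qed.

Lemma vjoin_rjoin (V1 V2 W1 W2 : ctx L) (r1 : renaming V1 W1)
    (r2 : renaming V2 W2) (a : vtuple M W1) (b : vtuple M W2) :
  (fun s v => vjoin a b (rjoin r1 r2 v)) =
  vjoin (fun s v => a s (r1 s v)) (fun s v => b s (r2 s v)).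
Proof.
apply: functional_extensionality_dep => s.
by apply: functional_extensionality_dep => -[].
Qed.

Lemma sat_frename (V W : ctx L) (r : renaming V W) (p : formula V)
    (a : vtuple M W) :
  sat a (frename r p) <-> sat (fun s v => a s (r s v)) p.
Proof.
elim: p W r a => {V}
  [V|V s t u|V q u|V p IHp|V p1 IH1 p2 IH2|V t p IHp] W r a //=.
- by rewrite !teval_trename.
- suff -> : (fun s i => teval a (trename r (u s i))) =
      (fun s i => teval (fun s v => a s (r s v)) (u s i)) by [].
  apply: functional_extensionality_dep => s.
  by apply: functional_extensionality_dep => i; rewrite teval_trename.
- by rewrite IHp.
- by rewrite IH1 IH2.
- by split=> -[c]; exists c; [rewrite -(vjoin_rjoin r (fun _ v => v)) -IHp|
    rewrite IHp vjoin_rjoin].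
Qed.

Definition vcons t (y : seq (srt L)) (m : M t) (a : vtuple M (vars y)) :
    vtuple M (vars (t :: y)) := fun s v =>
  match v with inl e => eq_rect t M m s e | inr w => a s w end.

End Renaming.

(** Contexts met under quantifiers are made from finite lists by [cjoin]; this
    renaming flattens them back to lists, which is how a formula in any such
    context becomes the label of a Skolem function. *)
Definition rbind (L : signature) (V : ctx L) t (y : seq (srt L))
    (r : renaming V (vars y)) : renaming (cjoin V (vars [:: t])) (vars (t :: y)) :=
  fun s v => match v with
  | inl w => inr (r s w)
  | inr (inl e) => inl e
  | inr (inr w) => match w with end
  end.

Lemma vcons_rbind (L : signature) (M : structure L) (V : ctx L) t
    (y : seq (srt L)) (r : renaming V (vars y)) (c : vtuple M (vars [:: t]))
    (a : vtuple M (vars y)) :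
  (fun s v => vcons (c t (inl erefl)) a (rbind r v)) =
  vjoin (fun s v => a s (r s v)) c.
Proof.
apply: functional_extensionality_dep => s.
by apply: functional_extensionality_dep => -[//|[e|[]]]; case: s / e.
Qed.

(** A Skolem label is a formula whose first variable is to be witnessed. *)
Section Skolem.
Variables (L : signature) (M : structure L).

Definition sk_label := {t : srt L & {y : seq (srt L) & formula (vars (t :: y))}}.

Definition sk_args (l : sk_label) : seq (srt L) := tag (tagged l).

Definition sk_form (l : sk_label) : formula (vars (tag l :: sk_args l)) :=
  tagged (tagged l).

Lemma skolem_functions :
  exists sk : forall l : sk_label, vtuple M (vars (sk_args l)) -> M (tag l),
    forall l a m, sat (vcons m a) (sk_form l) -> sat (vcons (sk l a) a) (sk_form l).
Proof.
have skP l (a : vtuple M (vars (sk_args l))) : {m0 : M (tag l) |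
    forall m, sat (vcons m a) (sk_form l) -> sat (vcons m0 a) (sk_form l)}.
  apply: cid; have [[m Hm]|noex] := pselect (exists m, sat (vcons m a) (sk_form l)).
    by exists m.
  by have [m0] := carrier_inh M (tag l); exists m0 => m Hm; case: noex; exists m.
exists (fun l a => sval (skP l a)) => l a m; case: (skP l a) => m0 /= H; exact: H.
Qed.

Variables (P : ctx L) (p : vtuple M P) (A : Type) (num : nat -> A)
  (pr : A -> A -> A) (eP : {s & P s} -> A) (el : sk_label -> A)
  (sk : forall l : sk_label, vtuple M (vars (sk_args l)) -> M (tag l)).
Hypotheses (num_inj : injective num)
  (pr_inj : forall a b c d, pr a b = pr c d -> a = c /\ b = d)
  (eP_inj : injective eP) (el_inj : injective el)
  (skP : forall l a m,
     sat (vcons m a) (sk_form l) -> sat (vcons (@sk l a) a) (sk_form l)).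

(** [hull c w]: the code [c] describes a Skolem term over the tuple [p] with value
    [w]. Working with codes and not with a type of Skolem terms gives the
    cardinality bound at once, from [hull_functional]. *)
Inductive hull : A -> {s & M s} -> Prop :=
| hull_gen s (v : P s) : hull (pr (num 0) (eP (existT _ s v))) (existT _ s (@p s v))
| hull_sk l (g : forall s, vars (sk_args l) s -> A) a :
    (forall s v, hull (g s v) (existT _ s (a s v))) ->
    hull (pr (num 1) (pr (el l) (code_args num pr g))) (existT _ _ (@sk l a)).

Lemma hull_functional c w w' : hull c w -> hull c w' -> w = w'.
Proof.
suff H d : hull c w -> hull d w' -> c = d -> w = w' by move=> cw cw'; exact: (H c).
move=> cw; elim: cw d w' => {c w} [s v|l g a _ IH] d w' [s' v'|l' g' a' Ha'].
- move=> /pr_inj[_ /eP_inj E].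
  exact: (congr1 (fun w => existT M (tag w) (@p _ (tagged w))) E).
- by move=> /pr_inj[/num_inj].
- by move=> /pr_inj[/num_inj].
move=> /pr_inj[_ /pr_inj[/el_inj ll]].
case: l' / ll g' a' Ha' => g' a' Ha' /(code_args_inj pr_inj) gg.
congr existT; congr sk; apply: functional_extensionality_dep => s.
apply: functional_extensionality_dep => v.
exact: existT_inj (IH s v _ _ (Ha' s v) (gg s v)).
Qed.

Definition hull_sort s := {m : M s | exists c, hull c (existT _ s m)}.

Definition hull_incl s : hull_sort s -> M s := @sval _ _.

Lemma hull_incl_inj s : injective (@hull_incl s).
Proof. exact: sval_inj. Qed.

Lemma hull_closed l (a : vtuple hull_sort (vars (sk_args l))) :
  exists c, hull c (existT _ _ (@sk l (vmap hull_incl a))).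
Proof.
have codeP s v : {c | hull c (existT _ s (hull_incl (a s v)))}.
  by apply: cid; exact: (svalP (a s v)).
exists (pr (num 1) (pr (el l) (code_args num pr (fun s v => sval (codeP s v))))).
by apply: hull_sk => s v; case: codeP.
Qed.

(** A Skolem function without arguments provides an element of each sort. *)
Lemma hull_inh s : inhabited (hull_sort s).
Proof.
pose l : sk_label := existT _ s (existT _ [::] (Fbot _)).
have c := @hull_closed l (fun s v => match v with end).
by constructor; exact: (exist _ _ c).
Qed.

(** The value of a function symbol is the only witness of its graph, so closure
    under Skolem functions gives closure under function symbols. *)
Lemma hull_finterp (f : Defs.fsym L) (a : vtuple hull_sort (vars (fdom f))) :
  exists c, hull c (existT _ _ (finterp (vmap hull_incl a))).
Proof.
pose phi : formula (vars (fcod f :: fdom f)) :=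
  Feq (Tvar (inl erefl)) (Tapp (fun s (i : vars (fdom f) s) =>
    @Tvar L (vars (fcod f :: fdom f)) s (inr i))).
pose l : sk_label := existT _ _ (existT _ _ phi).
have -> : finterp (vmap hull_incl a) = @sk l (vmap hull_incl a).
  by symmetry; exact: (@skP l (vmap hull_incl a) (finterp (vmap hull_incl a)) erefl).
exact: (@hull_closed l).
Qed.

Definition hull_structure : structure L := @Structure L hull_sort hull_inh
  (fun f a => exist _ _ (hull_finterp a)) (fun r a => rinterp (vmap hull_incl a)).

Lemma teval_hull V (a : vtuple hull_structure V) s (t : term V s) :
  hull_incl (teval a t) = teval (vmap hull_incl a) t.
Proof.
elim: t => [//|f u IHu] /=; congr finterp.
apply: functional_extensionality_dep => s'.
by apply: functional_extensionality_dep => i; exact: IHu.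
Qed.

Lemma vmap_vcons t y (m : hull_structure t) (a : vtuple hull_structure (vars y)) :
  vmap hull_incl (vcons m a) = vcons (hull_incl m) (vmap hull_incl a).
Proof.
apply: functional_extensionality_dep => s.
by apply: functional_extensionality_dep => -[e|//]; case: s / e.
Qed.

(** The Tarski-Vaught argument. The renaming into a finite list [y] of variables
    makes the statement pass under quantifiers while keeping the parameters of the
    Skolem functions finite in number. *)
Lemma sat_hull V (q : formula V) y (r : renaming V (vars y))
    (a : vtuple hull_structure (vars y)) :
  sat (fun s v => a s (r s v)) q <->
  sat (fun s v => vmap hull_incl a (r s v)) q.
Proof.
elim: q y r a => {V}
  [V|V s t u|V q u|V q IHq|V q1 IH1 q2 IH2|V t q IHq] y r a //=.
- rewrite -[fun s v => vmap _ _ _]/(vmap hull_incl (fun s v => a s (r s v))).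
  rewrite -!teval_hull; split=> [->//|]; exact: hull_incl_inj.
- suff -> : vmap hull_incl (fun s i => teval (fun s v => a s (r s v)) (u s i)) =
      (fun s i => teval (fun s v => vmap hull_incl a (r s v)) (u s i)) by [].
  apply: functional_extensionality_dep => s.
  by apply: functional_extensionality_dep => i; exact: teval_hull.
- by rewrite IHq.
- by rewrite IH1 IH2.
split=> -[c].
  rewrite -(@vcons_rbind L hull_structure V t y r c a) IHq vmap_vcons => qc.
  exists (vmap hull_incl c).
  by rewrite -(vcons_rbind r).
pose l : sk_label := existT _ t (existT _ y (frename (@rbind L V t y r) q)).
rewrite -(vcons_rbind r) -sat_frename => /(@skP l _ _) /sat_frename.
pose m : hull_structure t := exist _ _ (@hull_closed l a).
rewrite -[@sk l _]/(hull_incl m) -vmap_vcons -IHq => qm.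
exists (fun s (v : vars [:: t] s) => match v with
  | inl e => eq_rect t _ m s e | inr w => match (w : void) with end end).
by rewrite -(@vcons_rbind L hull_structure V t y r _ a).
Qed.

Lemma elementary_hull : elementary (N := hull_structure) hull_incl.
Proof. by move=> y q a; exact: (sat_hull q (fun _ v => v)). Qed.

Lemma hull_gens : exists q : vtuple hull_structure P, vmap hull_incl q = p.
Proof.
exists (fun s v => exist (fun m => exists c, hull c (existT _ s m)) (@p s v)
  (ex_intro _ _ (hull_gen v))).
by [].
Qed.

Lemma embeds_hull : embeds {s & hull_structure s} A.
Proof.
have codeP (w : {s & hull_structure s}) :
    {c | hull c (existT _ (tag w) (hull_incl (tagged w)))}.
  by apply: cid; exact: (svalP (tagged w)).
exists (fun w => sval (codeP w)) => -[s m] [s' m'] cc.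
have := svalP (codeP (existT _ s' m')); rewrite -cc.
move=> /(hull_functional (svalP (codeP (existT _ s m)))) /= E {cc}.
have ss := projT1_eq E; rewrite /= in ss.
case: s' / ss m' E => m' E; congr existT; apply: hull_incl_inj; exact: existT_inj E.
Qed.

End Skolem.

(** The cardinal is given by the type [A]: it is infinite and bounds the language
    and the tuple of generators. *)
Theorem downward_LoewenheimSkolem (A : Type) (L : signature) (M : structure L)
    (P : ctx L) (p : vtuple M P) :
  embeds nat A -> lang_embeds L A -> embeds {s & P s} A ->
  exists (N : structure L) (i : vtuple M N),
    [/\ elementary i, embeds {s & N s} A & exists q : vtuple N P, vmap i q = p].
Proof.
move=> natA LA [eP eP_inj]; have [sA _ _] := LA.
have [num num_inj] := natA; have [pr pr_inj] := embeds_pairing natA.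
have [el el_inj] : embeds (sk_label L) A.
  apply: embeds_sigT => // t; apply: embeds_sigT => // [|y]; first exact: embeds_seq.
  by apply: embeds_formula => //; exact: embeds_trans (embeds_vars _) natA.
have [sk skP] := skolem_functions M.
exists (hull_structure p num pr eP el skP), (@hull_incl _ _ _ p _ num pr eP el sk).
split; [exact: elementary_hull|exact: embeds_hull|exact: hull_gens].
Qed.

(** * Definable sets and type-definability *)

Section FirstOrder.
Variables (L : signature) (M : structure L).

Definition fo_definable (V : ctx L) (D : set (vtuple M V)) :=
  exists phi : formula V, forall a, sat a phi <-> D a.

Lemma fo_definableC (V : ctx L) (D : set (vtuple M V)) :
  fo_definable D -> fo_definable (~` D).
Proof. by move=> [phi phiD]; exists (Fnot phi) => a /=; rewrite phiD. Qed.

Lemma fo_definableU (V : ctx L) (D E : set (vtuple M V)) :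
  fo_definable D -> fo_definable E -> fo_definable (D `|` E).
Proof.
by move=> [phi phiD] [psi psiE]; exists (For phi psi) => a /=; rewrite phiD psiE.
Qed.

Lemma fo_definableI (V : ctx L) (D E : set (vtuple M V)) :
  fo_definable D -> fo_definable E -> fo_definable (D `&` E).
Proof.
move=> /fo_definableC D' /fo_definableC E'.
by rewrite -[D `&` E]setCK setCI; exact/fo_definableC/fo_definableU.
Qed.

Lemma fo_definable_renaming (V W : ctx L) (r : renaming V W) (D : set (vtuple M V)) :
  fo_definable D -> fo_definable [set a : vtuple M W | D (fun s v => a s (r s v))].
Proof.
by move=> [phi phiD]; exists (frename r phi) => a; rewrite sat_frename phiD.
Qed.

(** Quantification over a finite tuple, by induction on its length: a single
    quantifier binds one variable. *)
Lemma fo_definable_ex (V : ctx L) (y : seq (srt L))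
    (D : set (vtuple M (cjoin V (vars y)))) :
  fo_definable D -> fo_definable [set a | exists b, D (vjoin a b)].
Proof.
elim: y V D => [|t y IHy] V D Ddef.
  pose r : renaming (cjoin V (vars [::])) V := fun s v =>
    match v with inl w => w | inr w => match (w : void) with end end.
  have [phi phiD] := fo_definable_renaming r Ddef; exists phi => a.
  have vjoinE b : vjoin a b = (fun s v => a s (r s v)).
    apply: functional_extensionality_dep => s.
    by apply: functional_extensionality_dep => -[].
  rewrite phiD /=; split=> [Da|[b]]; last by rewrite vjoinE.
  by exists (vnil M); rewrite vjoinE.
pose r : renaming (cjoin V (vars (t :: y)))
    (cjoin (cjoin V (vars [:: t])) (vars y)) :=
  fun s v => match v with
  | inl w => inl (inl w)
  | inr (inl e) => inl (inr (inl e))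
  | inr (inr w) => inr w
  end.
have [phi phiD] := IHy _ _ (fo_definable_renaming r Ddef).
have vjoin_r a (c : vtuple M (vars [:: t])) (b : vtuple M (vars y))
    (b' : vtuple M (vars (t :: y))) :
    (forall s e, b' s (inl e) = c s (inl e)) -> (forall s w, b' s (inr w) = b s w) ->
    vjoin a b' = (fun s v => vjoin (vjoin a c) b (r s v)).
  move=> b'c b'b; apply: functional_extensionality_dep => s.
  by apply: functional_extensionality_dep => -[|[]] /=.
exists (Fex phi) => a; split=> /= [[c /phiD[b Db]]|[b Db]].
  exists (vcons (c t (inl erefl)) b); rewrite (vjoin_r a c b) // => s e.
  by case: s / e.
pose c : vtuple M (vars [:: t]) := fun s v =>
  match v with inl e => b s (inl e) | inr w => match (w : void) with end end.
exists c; apply/phiD; exists (fun s w => b s (inr w)).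
by rewrite /= -(vjoin_r a c (fun s w => b s (inr w)) b).
Qed.

Lemma fo_definable_all (V : ctx L) (y : seq (srt L))
    (D : set (vtuple M (cjoin V (vars y)))) :
  fo_definable D -> fo_definable [set a | forall b, D (vjoin a b)].
Proof.
move=> /fo_definableC/fo_definable_ex/fo_definableC; congr fo_definable.
apply/seteqP; split=> a /=.
  by move=> + b; apply: contra_notP; exists b.
by move=> Da [b].
Qed.

Lemma fo_definable_exists_fin (T : finType) (V : ctx L) (D : T -> set (vtuple M V)) :
  (forall t, fo_definable (D t)) -> fo_definable [set a | exists t, D t a].
Proof.
move=> Ddef.
suff [phi phiD] : fo_definable [set a | exists2 t, t \in enum T & D t a].
  by exists phi => a; rewrite phiD; split=> [[t _ Dt]|[t Dt]]; exists t;
    rewrite ?mem_enum.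
elim: (enum T) => [|t s IHs]; first by exists (Fbot V) => a /=; split=> // -[].
have [phi phiD] := fo_definableU (Ddef t) IHs.
exists phi => a; rewrite phiD; split=> [[Dt|[u us Du]]|[u]] /=.
- by exists t; rewrite ?mem_head.
- by exists u; rewrite // in_cons us orbT.
- by rewrite in_cons => /orP[/eqP->|us Du]; [left|right; exists u].
Qed.

Lemma fo_definable_forall_fin (T : finType) (V : ctx L) (D : T -> set (vtuple M V)) :
  (forall t, fo_definable (D t)) -> fo_definable [set a | forall t, D t a].
Proof.
move=> Ddef.
have /fo_definableC := fo_definable_exists_fin (fun t => fo_definableC (Ddef t)).
congr fo_definable; apply/seteqP; split=> a /= => [noex t|Da [t]]; last exact.
by apply: contrapT => Dt; apply: noex; exists t.
Qed.

(** Functions with finitely many values and first-order definable fibres; any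
    condition on their values is then expressed by one formula. *)
Definition simple (V : ctx L) Z (h : vtuple M V -> Z) :=
  exists (T : finType) (g : vtuple M V -> T) (u : T -> Z),
    (forall t, fo_definable [set a | g a = t]) /\ forall a, h a = u (g a).

Lemma simple_pair (V : ctx L) Z1 Z2 (h1 : vtuple M V -> Z1) (h2 : vtuple M V -> Z2) :
  simple h1 -> simple h2 -> simple (fun a => (h1 a, h2 a)).
Proof.
move=> [T1 [g1 [u1 [g1P h1E]]]] [T2 [g2 [u2 [g2P h2E]]]].
exists (T1 * T2)%type, (fun a => (g1 a, g2 a)), (fun t => (u1 t.1, u2 t.2)).
split=> [[t1 t2]|a]; last by rewrite h1E h2E.
have := fo_definableI (g1P t1) (g2P t2); congr fo_definable.
by apply/seteqP; split=> a /= => [[-> ->]|[]].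
Qed.

Lemma simple_fo_definable (V : ctx L) Z (h : vtuple M V -> Z) (B : set Z) :
  simple h -> fo_definable [set a | B (h a)].
Proof.
move=> [T [g [u [gP hE]]]].
have := fo_definable_exists_fin (fun t : {t : T | `[< B (u t) >]} => gP (sval t)).
congr fo_definable; apply/seteqP; split=> a /=; rewrite hE.
  by move=> [[t /= /asboolP Bt] ->].
by move=> /asboolP Ba; exists (exist _ (g a) Ba).
Qed.

(** The fibre over [S] is the conjunction of the [D i], i in [S], and of the
    negations of the others. *)
Lemma simple_pattern (I : finType) (V : ctx L) Z (u : {set I} -> Z)
    (D : I -> set (vtuple M V)) :
  (forall i, fo_definable (D i)) -> simple (fun a => u [set i | `[< D i a >]]%SET).
Proof.
move=> Ddef; exists {set I}, (fun a => [set i | `[< D i a >]]%SET), u.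
split=> // S.
have : fo_definable [set a | forall i, (if i \in S then D i else ~` D i) a].
  by apply: fo_definable_forall_fin => i; case: ifP => _ //; exact: fo_definableC.
congr fo_definable; apply/seteqP; split=> a /=.
  move=> Sa; apply/setP => i; rewrite inE; move: (Sa i).
  by case: (i \in S) => ?; apply/asboolP.
by move=> <- i; rewrite inE; case: asboolP.
Qed.

Section TypeDefinable.
Variables (V P : ctx L) (p : vtuple M P).

Lemma type_definable_fo (D : set (vtuple M (cjoin V P))) :
  fo_definable D -> type_definable p [set a : vtuple M V | D (vjoin a p)].
Proof.
move=> [phi phiD]; exists [set phi]; apply/seteqP; split=> a /=.
  by move=> Da _ ->; rewrite phiD.
by move=> /(_ phi erefl); rewrite phiD.
Qed.

(** [I] is any type, so a proposition is allowed as index; this handles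
    hypotheses that do not depend on the tuple. *)
Lemma type_definable_all (I : Type) (D : I -> set (vtuple M V)) :
  (forall i, type_definable p (D i)) -> type_definable p [set a | forall i, D i a].
Proof.
move=> Dtd; exists [set phi | exists i, forall a, D i a -> sat (vjoin a p) phi].
apply/seteqP; split=> a /=; first by move=> Da phi [i]; apply.
move=> Sa i; have [Sigma DE] := Dtd i; rewrite DE => phi Sphi.
by apply: Sa; exists i => b; rewrite DE; apply.
Qed.

Lemma type_definableI (D E : set (vtuple M V)) :
  type_definable p D -> type_definable p E -> type_definable p (D `&` E).
Proof.
move=> Dtd Etd.
have : type_definable p [set a | forall b : bool, (if b then D else E) a].
  by apply: type_definable_all => -[].
congr type_definable; apply/seteqP; split=> a /=.
  by move=> H; split; [exact: (H true)|exact: (H false)].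
by move=> [Da Ea] [].
Qed.

End TypeDefinable.

Lemma type_definable0 (V : ctx L) (D : set (vtuple M V)) :
  fo_definable D -> type_definable (vnil M) D.
Proof.
move=> Ddef.
exact: type_definable_fo (fo_definable_renaming (fun _ v => inl v) Ddef).
Qed.

Section SimpleAverages.
Variables (R : realType) (x : seq (srt L)).

(** Renamings serve as projections: [ra] and [rb] select the x-tuple and the
    parameter inside one ambient tuple [c]. *)
Lemma fo_definable_pset (W : ctx L) (phi : pformula x) (ra : renaming (vars x) W)
    (rb : renaming (vars (pvars phi)) W) :
  fo_definable
    [set c | pset phi (fun s v => c s (rb s v)) (fun s v => c s (ra s v))].
Proof.
pose r : renaming (cjoin (vars x) (vars (pvars phi))) W := fun s v =>
  match v with inl w => ra s w | inr w => rb s w end.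
exists (frename r (pform phi)) => c; rewrite sat_frename.
suff -> : (fun s v => c s (r s v)) =
    vjoin (fun s v => c s (ra s v)) (fun s v => c s (rb s v)) by [].
apply: functional_extensionality_dep => s.
by apply: functional_extensionality_dep => -[].
Qed.

(** An average depends only on which of the finitely many points satisfy phi. *)
Lemma simple_Av (W : ctx L) (phi : pformula x) m (ra : 'I_m -> renaming (vars x) W)
    (rb : renaming (vars (pvars phi)) W) :
  simple (fun c => Av R (fun i s v => c s (ra i s v)) phi (fun s v => c s (rb s v))).
Proof.
pose u (S : {set 'I_m}) : R := (#|S|%:R / m%:R)%R.
exact: (simple_pattern u (fun i => fo_definable_pset (ra i) rb)).
Qed.

Variable n : pformula x -> nat -> nat.

Lemma simple_AvX (W : ctx L) (phi : pformula x) k (ra : renaming (big_ctx n) W)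
    (rb : renaming (vars (pvars phi)) W) :
  simple (fun c : vtuple M W =>
    AvX R (n := n) (fun s v => c s (ra s v)) k (fun s v => c s (rb s v))).
Proof.
exact: (simple_Av (fun i s v => ra s (existT _ phi (existT _ k (i, v)))) rb).
Qed.

End SimpleAverages.
End FirstOrder.

Local Open Scope ring_scope.

(** * Type-definability of the space and of its equivalence relation *)

Section SpaceDefinable.
Variables (R : realType) (L : signature) (M : structure L) (x : seq (srt L)).
Variable n : pformula x -> nat -> nat.

Lemma type_definable_Xset' : type_definable (vnil M) (@Xset' R L M x n).
Proof.
apply: type_definable_all => phi; apply: type_definable_all => k.
apply: type_definable_all => k1; apply: type_definable_all => k2.
do 2! [apply: type_definable_all => _].
apply: type_definable0.
pose W := cjoin (big_ctx n) (vars (pvars phi)).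
pose ra : renaming (big_ctx n) W := fun _ => inl.
pose rb : renaming (vars (pvars phi)) W := fun _ => inr.
have S12 := simple_pair (simple_AvX M R k1 ra rb) (simple_AvX M R k2 ra rb).
exact: (fo_definable_all (simple_fo_definable
  (fun z => `|z.1 - z.2| <= 2 * inv_nat R k) S12)).
Qed.

Lemma type_definable_Xset : type_definable (vnil M) (@Xset R L M x n).
Proof.
apply: type_definableI; first exact: type_definable_Xset'.
apply: type_definable_all => phi1; apply: type_definable_all => phi2.
apply: type_definable_all => k; apply: type_definable0.
pose W := cjoin (cjoin (big_ctx n) (vars (pvars phi1))) (vars (pvars phi2)).
pose ra : renaming (big_ctx n) W := fun _ v => inl (inl v).
pose rb1 : renaming (vars (pvars phi1)) W := fun _ v => inl (inr v).
pose rb2 : renaming (vars (pvars phi2)) W := fun _ v => inr v.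
pose rb : renaming (vars (pvars phi1 ++ pvars phi2)) W := fun s v =>
  match vsplit v with inl v1 => rb1 s v1 | inr v2 => rb2 s v2 end.
have vcat_rb (c : vtuple M W) :
    vcat (fun s v => c s (rb1 s v)) (fun s v => c s (rb2 s v)) =
    (fun s v => c s (rb s v)).
  apply: functional_extensionality_dep => s.
  apply: functional_extensionality_dep => v.
  by rewrite /vcat /rb; case: vsplit.
have Sim := simple_pair (simple_AvX (phi := pdisj phi1 phi2) M R k ra rb)
  (simple_pair (simple_AvX M R k ra rb1) (simple_AvX M R k ra rb2)).
have Bdef := simple_fo_definable
  (fun z => `|z.1 - (z.2.1 + z.2.2)| <= 3 * inv_nat R k) Sim.
have Ddef : fo_definable [set c : vtuple M W |
    pset phi1 (fun s v => c s (rb1 s v)) `&`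
    pset phi2 (fun s v => c s (rb2 s v)) = set0].
  pose w W' (r : renaming W' W) : renaming W' (cjoin W (vars x)) :=
    fun s v => inl (r s v).
  pose rx : renaming (vars x) (cjoin W (vars x)) := fun _ v => inr v.
  have := fo_definable_all (fo_definableC (fo_definableI
    (fo_definable_pset M rx (w _ rb1)) (fo_definable_pset M rx (w _ rb2)))).
  congr fo_definable; apply/seteqP; split=> c /= cP; last first.
    by move=> a; move/seteqP: cP => [+ _] => /(_ a).
  by apply/seteqP; split=> // a; exact: cP.
have := fo_definable_all (fo_definable_all
  (fo_definableU (fo_definableC Ddef) Bdef)).
congr fo_definable; apply/seteqP; split=> a /= aP b1 b2.
  have [//|+ disj] := aP b1 b2.
  by rewrite -vcat_rb.
have [disj|] := pselect (pset phi1 b1 `&` pset phi2 b2 = set0); last by left.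
by right; rewrite -vcat_rb; exact: aP.
Qed.

Lemma type_definable_Erel : type_definable (vnil M)
  [set c : vtuple M (cjoin (big_ctx n) (big_ctx n)) |
     Erel R (fun s v => c s (inl v)) (fun s v => c s (inr v))].
Proof.
apply: type_definable_all => phi; apply: type_definable_all => k.
apply: type_definable0.
pose W := cjoin (cjoin (big_ctx n) (big_ctx n)) (vars (pvars phi)).
pose ra1 : renaming (big_ctx n) W := fun _ v => inl (inl v).
pose ra2 : renaming (big_ctx n) W := fun _ v => inl (inr v).
pose rb : renaming (vars (pvars phi)) W := fun _ v => inr v.
have S12 := simple_pair (simple_AvX M R k ra1 rb) (simple_AvX M R k ra2 rb).
exact: (fo_definable_all (simple_fo_definable
  (fun z => `|z.1 - z.2| <= 4 * inv_nat R k) S12)).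
Qed.

End SpaceDefinable.

(** * Averages and Keisler measures *)

Section Averages.
Variables (R : realType) (L : signature) (M : structure L) (x : seq (srt L)).
Implicit Types (phi : pformula x).

Lemma Av_ge0 m (a : 'I_m -> vtuple M (vars x)) phi b : 0 <= Av R a phi b.
Proof. by rewrite divr_ge0. Qed.

Lemma Av_setT m (a : 'I_m -> vtuple M (vars x)) phi b :
  (0 < m)%N -> pset phi b = setT -> Av R a phi b = 1.
Proof.
move=> m_gt0 phiT; rewrite /Av (_ : [set i | _]%SET = [set: 'I_m]%SET).
  by rewrite cardsT card_ord divff // pnatr_eq0 -lt0n.
by apply/setP => i; rewrite !inE phiT; exact/asboolP.
Qed.

Lemma Av_gt0 m (a : 'I_m -> vtuple M (vars x)) phi b :
  0 < Av R a phi b -> exists i, pset phi b (a i).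
Proof.
move=> Av_gt0; apply: contrapT => noi; move: Av_gt0.
rewrite /Av (_ : [set i | _]%SET = finset.set0) ?cards0 ?mul0r ?ltxx //.
by apply/setP => i; rewrite !inE; apply/asboolP => ai; apply: noi; exists i.
Qed.

Lemma pset_pdisj phi1 phi2 (b1 : vtuple M (vars (pvars phi1)))
    (b2 : vtuple M (vars (pvars phi2))) :
  pset (pdisj phi1 phi2) (vcat b1 b2) = pset phi1 b1 `|` pset phi2 b2.
Proof.
have vsplitl (y1 y2 : seq (srt L)) s (v : vars y1 s) :
    vsplit (vlshift y2 v) = inl v.
  by elim: y1 v => [|t y1 IHy] //= [//|v]; rewrite IHy.
have vsplitr (y1 y2 : seq (srt L)) s (v : vars y2 s) :
    vsplit (vrshift y1 v) = inr v.
  by elim: y1 => [|t y1 IHy] //=; rewrite IHy.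
apply/funext => a; rewrite /pset /= /setU /mkset.
rewrite !(propext (sat_frename _ _ _)) !vjoin_rjoin.
have -> : (fun s v => vcat b1 b2 (vlshift (pvars phi2) v)) = b1.
  apply: functional_extensionality_dep => s.
  by apply: functional_extensionality_dep => v; rewrite /vcat vsplitl.
have -> // : (fun s v => vcat b1 b2 (vrshift (pvars phi1) v)) = b2.
apply: functional_extensionality_dep => s.
by apply: functional_extensionality_dep => v; rewrite /vcat vsplitr.
Qed.

Definition pnot phi : pformula x := PFormula (Fnot (pform phi)).

Lemma pset_pnot phi (b : vtuple M (vars (pvars phi))) :
  pset (pnot phi) b = ~` pset phi b.
Proof. by []. Qed.

Lemma keisler_ext (mu nu : keisler R M x) :
  (forall phi b, mu (inst phi b) = nu (inst phi b)) -> mu = nu.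
Proof.
move=> mu_nu; have {mu_nu} : meas mu = meas nu.
  apply/funext => -[D Ddef]; have [phi [b DE]] := Ddef.
  subst D; have := mu_nu phi b.
  by rewrite /inst (Prop_irrelevance (ex_intro _ _ _) Ddef).
case: mu nu => [m m0 mT mA] [m' m'0 m'T m'A] /= mm'; subst m'.
by congr Keisler; exact: Prop_irrelevance.
Qed.

(** The Dirac measure at a point. *)
Lemma keisler_inh : inhabited (keisler R M x).
Proof.
have pt s : {m : M s | True} by apply: cid; have [m] := carrier_inh M s; exists m.
pose a : vtuple M (vars x) := fun s _ => sval (pt s).
pose m (D : defset M x) : R := `[< sval D a >]%:R.
have m0 D : 0 <= m D by exact: ler0n.
have mT D : sval D = setT -> m D = 1 by move=> DT; rewrite /m DT asboolT.
have mA D1 D2 D : sval D1 `&` sval D2 = set0 -> sval D = sval D1 `|` sval D2 ->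
    m D = m D1 + m D2.
  move=> D12 DU; rewrite /m DU asbool_or -natrD.
  case: asboolP => [D1a|_]; case: asboolP => [D2a|_] //=.
  by have : (sval D1 `&` sval D2) a by []; rewrite D12.
by constructor; exact: (Keisler m0 mT mA).
Qed.

End Averages.

(** * Sequences converging at rate 1/k *)

Section Rates.
Variable R : realType.
Implicit Types (c l z : R) (u : nat -> R).

Lemma inv_nat_gt0 k : 0 < inv_nat R k.
Proof. by rewrite invr_gt0 ltr0n. Qed.

Lemma inv_nat_le j k : (j <= k)%N -> inv_nat R k <= inv_nat R j.
Proof. by move=> jk; rewrite lef_pV2 ?posrE ?ltr0n // ler_nat. Qed.

Lemma inv_nat_small c z : 0 < c -> 0 < z -> exists k, c * inv_nat R k < z.
Proof.
move=> c0 z0; have [k] := ltr_add_invr (divr_gt0 z0 c0).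
by rewrite add0r ltr_pdivlMr // mulrC => kz; exists k.
Qed.

Lemma rate_le0 c z : 0 < c -> (forall k, z <= c * inv_nat R k) -> z <= 0.
Proof.
move=> c0 zc; rewrite leNgt; apply/negP => /(inv_nat_small c0)[k].
by rewrite ltNge zc.
Qed.

Lemma rate_eq c z l : 0 < c -> (forall k, `|z - l| <= c * inv_nat R k) -> z = l.
Proof.
by move=> c0 /(rate_le0 c0); rewrite normr_le0 subr_eq0 => /eqP.
Qed.

Lemma rate_cvg c u l : 0 < c ->
  (forall k, `|u k - l| <= c * inv_nat R k) -> u @ \oo --> l.
Proof.
move=> c0 ul; apply/cvgrPdist_lt => e /(inv_nat_small c0)[k ke].
exists k => // j /= kj; rewrite distrC; apply: le_lt_trans (ul j) _.
by apply: le_lt_trans ke; rewrite ler_pM2l // inv_nat_le.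
Qed.

Lemma rate_cauchy c u : 0 < c ->
  (forall k j, (k <= j)%N -> `|u k - u j| <= c * inv_nat R k) ->
  exists l, forall k, `|u k - l| <= c * inv_nat R k.
Proof.
move=> c0 u_rate.
have /cvg_ex[l ul] : cvg (u @ \oo).
  apply/cauchy_cvgP/cauchy_exP => e /(inv_nat_small c0)[k ke].
  exists (u k); exists k => // j /= kj; rewrite /ball /=.
  exact: le_lt_trans (u_rate _ _ kj) ke.
exists l => k; apply/ler_addgt0Pr => e e0.
have /cvgrPdist_le/(_ e e0)[j0 _ j0P] := ul.
have := j0P (maxn k j0) (leq_maxr _ _) => /=; rewrite distrC => uj.
rewrite (le_trans (ler_distD (u (maxn k j0)) _ _)) // lerD //.
by rewrite u_rate // leq_maxl.
Qed.

End Rates.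

(** * The measure attached to a point of the space *)

Section LimitMeasure.
Variables (R : realType) (L : signature) (M : structure L) (x : seq (srt L)).
Variable n : pformula x -> nat -> nat.
Hypothesis n_gt0 : forall phi k, (0 < n phi k)%N.
Variable a : bigtuple M n.
Hypothesis Xa : Xset R a.
Implicit Types phi : pformula x.

(** The limit is handled through its rate of convergence, which determines it and
    avoids passing to limits in inequalities. *)
Definition is_limit phi (b : vtuple M (vars (pvars phi))) (l : R) :=
  forall k, `|AvX R a k b - l| <= 2 * inv_nat R k.

Lemma is_limit_ex phi (b : vtuple M (vars (pvars phi))) : exists l, is_limit b l.
Proof.
by apply: rate_cauchy => // k j kj; apply: Xa.1.
Qed.

Lemma is_limit_ge0 phi (b : vtuple M (vars (pvars phi))) l : is_limit b l -> 0 <= l.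
Proof.
move=> bl; rewrite -oppr_le0; apply: (@rate_le0 _ 2) => // k.
apply: le_trans (bl k); rewrite -[leLHS]add0r.
by apply: le_trans (ler_norm _); rewrite lerD2r; exact: Av_ge0.
Qed.

Lemma is_limit_setT phi (b : vtuple M (vars (pvars phi))) l :
  is_limit b l -> pset phi b = setT -> l = 1.
Proof.
move=> bl bT; symmetry; apply: (@rate_eq _ 2) => // k.
by have := bl k; rewrite /AvX Av_setT.
Qed.

(** The defect of additivity is at most 3/k for the averages, plus 2/k for each of
    the three limits. *)
Lemma is_limit_pdisj phi1 phi2 (b1 : vtuple M (vars (pvars phi1)))
    (b2 : vtuple M (vars (pvars phi2))) l l1 l2 :
  pset phi1 b1 `&` pset phi2 b2 = set0 ->
  is_limit b1 l1 -> is_limit b2 l2 ->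
  is_limit (phi := pdisj phi1 phi2) (vcat b1 b2) l ->
  l = l1 + l2.
Proof.
move=> disj bl1 bl2 bl; apply: (@rate_eq _ 9) => // k.
have dl := Xa.2 phi1 phi2 k b1 b2 disj.
move: dl (bl1 k) (bl2 k) (bl k); rewrite !ler_norml.
by move=> *; apply/andP; split; lra.
Qed.

(** Both formulas are completed to the whole space by the same complement. *)
Lemma is_limit_unique phi1 phi2 (b1 : vtuple M (vars (pvars phi1)))
    (b2 : vtuple M (vars (pvars phi2))) l1 l2 :
  pset phi1 b1 = pset phi2 b2 -> is_limit b1 l1 -> is_limit b2 l2 -> l1 = l2.
Proof.
move=> b12 bl1 bl2.
have [l bl] := is_limit_ex (phi := pnot phi1) b1.
have compl phi (b : vtuple M (vars (pvars phi))) l' :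
    pset phi b = pset phi1 b1 -> is_limit b l' -> 1 = l' + l.
  move=> bb1 bl'.
  have [l'' bl''] := is_limit_ex (phi := pdisj phi (pnot phi1)) (vcat b b1).
  rewrite -(is_limit_pdisj _ bl' bl bl'') ?pset_pnot ?bb1 ?setICr //.
  by rewrite (is_limit_setT bl'') // pset_pdisj pset_pnot bb1 setUv.
by apply: (addIr l); rewrite -(compl _ _ _ erefl bl1) -(compl _ _ _ (esym b12) bl2).
Qed.

Lemma limit_measure_exists : exists nu : keisler R M x,
  forall phi (b : vtuple M (vars (pvars phi))), is_limit b (nu (inst phi b)).
Proof.
have mP (D : defset M x) : {l | forall phi (b : vtuple M (vars (pvars phi))),
    sval D = pset phi b -> is_limit b l}.
  apply: cid; have [phi [b Db]] := svalP D; have [l bl] := is_limit_ex b.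
  exists l => phi' b' Db'; have [l' bl'] := is_limit_ex b'.
  by rewrite (is_limit_unique _ bl bl') // -Db -Db'.
pose m D := sval (mP D).
have m_lim D phi (b : vtuple M (vars (pvars phi))) :
    sval D = pset phi b -> is_limit b (m D) by exact: svalP (mP D) phi b.
have m0 D : 0 <= m D.
  by have [phi [b Db]] := svalP D; exact: is_limit_ge0 (m_lim _ _ _ Db).
have mT D : sval D = setT -> m D = 1.
  move=> DT; have [phi [b Db]] := svalP D.
  by apply: is_limit_setT (m_lim _ _ _ Db) _; rewrite -Db.
have mA D1 D2 D : sval D1 `&` sval D2 = set0 -> sval D = sval D1 `|` sval D2 ->
    m D = m D1 + m D2.
  have [phi1 [b1 Db1]] := svalP D1; have [phi2 [b2 Db2]] := svalP D2.
  move=> D12 DU; apply: (@is_limit_pdisj phi1 phi2 b1 b2).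
  - by rewrite -Db1 -Db2.
  - exact: m_lim.
  - exact: m_lim.
  - by apply: m_lim; rewrite pset_pdisj -Db1 -Db2.
exists (Keisler m0 mT mA) => phi b; exact: m_lim.
Qed.

End LimitMeasure.

(** * Generic stability of the limit measures *)

(** Smallness bounds [nat] and the language separately; since the two are
    comparable, the larger one is an infinite type that bounds the language and is
    still smaller than [K]. *)
Lemma small_cardinal (K : Type) (L : signature) :
  card_small K nat -> card_small K (srt L + Defs.fsym L + rsym L)%type ->
  exists A, [/\ embeds nat A, lang_embeds L A & ~ embeds K A].
Proof.
set S := (srt L + Defs.fsym L + rsym L)%type.
move=> /negP nat_small /negP S_small.
have LS : lang_embeds L S.
  by split; [exists (inl \o inl)|exists (inl \o inr)|exists inr] => ? ? [].
have [natS|[f f_inj]] := embeds_total nat S.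
  by exists S; split=> // /embeds_card_le.
exists nat; split=> [||/embeds_card_le //]; first exact: embeds_refl.
by case: LS => ? ? ?; split; apply: embeds_trans; eauto; exists f.
Qed.

Lemma embeds_big_ctx (A : Type) (L : signature) (x : seq (srt L))
    (n : pformula x -> nat -> nat) :
  embeds nat A -> lang_embeds L A -> embeds {s & big_ctx n s} A.
Proof.
move=> natA LA; have [sA _ _] := LA.
apply: embeds_sigT => // s.
apply: embeds_sigT => // [|phi]; first exact: embeds_pformula.
apply: embeds_sigT => // k; apply: embeds_trans (embeds_square natA).
apply: embeds_prod; first by apply: embeds_trans natA; exists val; exact: val_inj.
apply: embeds_trans natA; apply: embeds_trans (embeds_vars x).
by exists (fun v => existT _ s v) => v w; exact: existT_inj.
Qed.

Section Stability.
Variables (R : realType) (L : signature) (M : structure L) (x : seq (srt L)).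
Variable n : pformula x -> nat -> nat.
Implicit Types (a : bigtuple M n) (nu : keisler R M x) (phi : pformula x).

(** The condition on b is cut out by the formulas stating that the k-th average is
    within 2/k of C; a value satisfying all of them is within 4/k of C for every k,
    hence in C, which is closed. *)
Lemma limit_definable (N : structure L) (i : vtuple M N)
    (q : vtuple N (big_ctx n)) nu :
  (forall phi b, is_limit (vmap i q : bigtuple M n) b (nu (inst phi b))) ->
  definable_over i nu.
Proof.
move=> lim phi C C_closed.
have -> : [set b : vtuple M (vars (pvars phi)) | C (nu (inst phi b))] =
    [set b | forall k, exists2 r, C r &
      `|AvX R (vmap i q : bigtuple M n) k b - r| <= 2 * inv_nat R k].
  apply/seteqP; split=> b /= => [Cb k|Cb].
    by exists (nu (inst phi b)) => //; exact: lim.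
  apply: C_closed => B /nbhs_ballP[e /= e_gt0 eB].
  have [k ke] : exists k, 4 * inv_nat R k < e by exact: inv_nat_small.
  have [r Cr rk] := Cb k; exists r; split=> //.
  apply: eB; rewrite /ball /=; apply: le_lt_trans ke; move: rk (lim _ b k).
  by rewrite !ler_norml => /andP[? ?] /andP[? ?]; apply/andP; split; lra.
apply: type_definable_all => k.
pose W := cjoin (vars (pvars phi)) N.
pose ra : renaming (big_ctx n) W := fun s v => inr (q s v).
pose rb : renaming (vars (pvars phi)) W := fun _ v => inl v.
have := type_definable_fo i (simple_fo_definable
  (fun z => exists2 r, C r & `|z - r| <= 2 * inv_nat R k) (simple_AvX M R k ra rb)).
exact.
Qed.

(** For k with 2/k below the measure, the k-th average is positive, and its points
    lie in N. *)
Lemma limit_finitely_satisfiable (N : structure L) (i : vtuple M N)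
    (q : vtuple N (big_ctx n)) nu :
  (forall phi b, is_limit (vmap i q : bigtuple M n) b (nu (inst phi b))) ->
  finitely_satisfiable_over i nu.
Proof.
move=> lim phi b b_gt0.
have [k kb] : exists k, 2 * inv_nat R k < nu (inst phi b) by exact: inv_nat_small.
have /Av_gt0[j bj] : 0 < AvX R (vmap i q : bigtuple M n) k b.
  by move: (lim phi b k); rewrite ler_norml => /andP[? ?]; lra.
by exists (fun s v => q s (existT _ phi (existT _ k (j, v)))).
Qed.

Lemma limit_generically_stable (K : Type) a nu :
  card_small K nat -> card_small K (srt L + Defs.fsym L + rsym L)%type ->
  (forall phi b, is_limit a b (nu (inst phi b))) -> generically_stable K nu.
Proof.
move=> nat_small L_small lim.
have [A [natA LA KA]] := small_cardinal nat_small L_small.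
have [N [i [i_el NA [q qa]]]] :=
  downward_LoewenheimSkolem a natA LA (embeds_big_ctx n natA LA).
rewrite -qa in lim; exists N, i; split=> //.
- apply/negP => /embeds_card_le KN; apply: KA; exact: embeds_trans NA.
- exact: limit_definable lim.
- exact: limit_finitely_satisfiable lim.
Qed.

Lemma approximating_Xset a nu : approximating a nu -> Xset R a.
Proof.
move=> app; split=> [phi k k1 k2 k1k k2k b|phi1 phi2 k b1 b2 disj].
  have := inv_nat_le R k1k; have := inv_nat_le R k2k.
  move: (app phi k1 b) (app phi k2 b); rewrite /AvX !ler_norml.
  by move=> /andP[? ?] /andP[? ?] ? ?; apply/andP; split; lra.
have nuU : nu (inst (pdisj phi1 phi2) (vcat b1 b2)) =
    nu (inst phi1 b1) + nu (inst phi2 b2).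
  by apply: meas_additive => //=; rewrite pset_pdisj.
move: (app (pdisj phi1 phi2) k (vcat b1 b2)) (app phi1 k b1) (app phi2 k b2).
rewrite nuU /AvX !ler_norml.
by move=> /andP[? ?] /andP[? ?] /andP[? ?]; apply/andP; split; lra.
Qed.

Lemma approximating_limit a nu phi b :
  approximating a nu -> is_limit a b (nu (inst phi b)).
Proof.
move=> app k; apply: le_trans (app phi k b) _.
by have := inv_nat_gt0 R k; lra.
Qed.

Lemma is_limit_Erel a a' phi b (l l' : R) : Erel R a a' ->
  is_limit (phi := phi) a b l -> is_limit a' b l' -> l = l'.
Proof.
move=> E al a'l'; apply: (@rate_eq _ 8) => // k.
move: (al k) (a'l' k) (E phi k b); rewrite !ler_norml.
by move=> /andP[? ?] /andP[? ?] /andP[? ?]; apply/andP; split; lra.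
Qed.

Lemma Erel_is_limit a a' (l : forall phi, vtuple M (vars (pvars phi)) -> R) :
  (forall phi b, is_limit a b (l phi b)) ->
  (forall phi b, is_limit a' b (l phi b)) ->
  Erel R a a'.
Proof.
move=> al a'l phi k b; move: (al phi b k) (a'l phi b k); rewrite !ler_norml.
by move=> /andP[? ?] /andP[? ?]; apply/andP; split; lra.
Qed.

Lemma hyperdefinable_Xset : (forall phi k, (0 < n phi k)%N) ->
  hyperdefinable (@Xset R L M x n) (Erel R).
Proof.
move=> n_gt0; split; [exact: type_definable_Xset|exact: type_definable_Erel|split].
- by move=> a _ phi k b; rewrite subrr normr0 mulr_ge0 // ltW // inv_nat_gt0.
- by move=> a b _ _ ab phi k c; rewrite distrC; exact: ab.
move=> a b c Xa Xb Xc ab bc.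
have [mu_a a_lim] := limit_measure_exists n_gt0 Xa.
have [mu_b b_lim] := limit_measure_exists n_gt0 Xb.
have [mu_c c_lim] := limit_measure_exists n_gt0 Xc.
have mu_ac : mu_a = mu_c.
  apply: keisler_ext => phi d.
  rewrite (is_limit_Erel ab (a_lim phi d) (b_lim phi d)).
  exact: is_limit_Erel bc (b_lim phi d) (c_lim phi d).
by apply: (@Erel_is_limit a c (fun phi d => mu_a (inst phi d))) => //; rewrite mu_ac.
Qed.

End Stability.

Theorem proposition3p25 (R : realType) (L : signature) (T : theory L)
    (K : Type) (M : structure L)
    (T_complete : complete_theory T) (T_NIP : NIP T) (M_monster : monster K T M)
    (x : seq (srt L)) (n : pformula x -> nat -> nat)
    (n_gt0 : forall phi k, (0 < n phi k)%N)
    (n_approx : forall mu : keisler R M x, generically_stable K mu ->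
       forall phi k, exists a : 'I_(n phi k) -> vtuple M (vars x),
         approximation (inv_nat R k) mu phi a)
    (abar : keisler R M x -> bigtuple M n)
    (abarP : forall mu, generically_stable K mu -> approximating (abar mu) mu) :
  let GS := [set mu : keisler R M x | generically_stable K mu] in
  let Xx : set (bigtuple M n) := Xset R in
  let Ex : bigtuple M n -> bigtuple M n -> Prop := Erel R in
  let cls : bigtuple M n -> set (bigtuple M n) := hclass Xx Ex in
  let Mtilde : set (set (bigtuple M n)) := hquotient Xx Ex in
  [/\ hyperdefinable Xx Ex,
      forall mu, GS mu -> Xx (abar mu),
      set_bij GS Mtilde (fun mu => cls (abar mu))
    & exists inv : set (bigtuple M n) -> keisler R M x,
        [/\ forall a, Xx a -> limit_measure a (inv (cls a)),
            forall c, Mtilde c -> GS (inv c),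
            forall mu, GS mu -> inv (cls (abar mu)) = mu
          & forall c, Mtilde c -> cls (abar (inv c)) = c]].
Proof.
move=> GS Xx Ex cls Mtilde.
have [_ [nat_small L_small] _ _] := M_monster.
have hyp : hyperdefinable Xx Ex := hyperdefinable_Xset R M n_gt0.
have [_ _ [Erefl Esym Etrans]] := hyp.
have GS_X mu : GS mu -> Xx (abar mu) by move=> /abarP/approximating_Xset.
have GS_lim mu : GS mu -> forall phi b, is_limit (abar mu) b (mu (inst phi b)).
  by move=> /abarP app phi b; exact: approximating_limit.
have cls_eq a b : Xx a -> Xx b -> Ex a b -> cls a = cls b.
  move=> Xa Xb ab; apply/seteqP; split=> c [Xc Ec]; split=> //.
    by apply: (Etrans b a c) => //; exact: Esym.
  exact: (Etrans a b c).
have muP c : {mu : keisler R M x | forall a, Xx a -> c = cls a ->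
    forall phi b, is_limit a b (mu (inst phi b))}.
  apply: cid; have [[a Xa ca]|noa] := pselect (exists2 a, Xx a & c = cls a).
    have [mu mu_lim] := limit_measure_exists n_gt0 Xa.
    exists mu => a' Xa' ca'; have [mu' mu'_lim] := limit_measure_exists n_gt0 Xa'.
    suff -> : mu = mu' by [].
    apply: keisler_ext => phi b.
    apply: (is_limit_Erel _ (mu_lim phi b) (mu'_lim phi b)).
    have : cls a a' by rewrite -ca ca'; split=> //; exact: Erefl.
    by case.
  by have [mu] := keisler_inh R M x; exists mu => a Xa ca; case: noa; exists a.
pose inv c := sval (muP c).
have inv_lim a : Xx a -> forall phi b, is_limit a b (inv (cls a) (inst phi b)).
  by move=> Xa; exact: (svalP (muP (cls a))).
have inv_GS a : Xx a -> GS (inv (cls a)).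
  by move=> /inv_lim; exact: limit_generically_stable.
have cls_inv a : Xx a -> cls (abar (inv (cls a))) = cls a.
  move=> Xa; have GSa := inv_GS a Xa; apply: cls_eq => //; first exact: GS_X.
  apply: (Erel_is_limit (l := fun phi b => inv (cls a) (inst phi b))).
    exact: GS_lim.
  exact: inv_lim.
have inv_cls mu : GS mu -> inv (cls (abar mu)) = mu.
  move=> GSmu; apply: keisler_ext => phi b.
  have Xmu := GS_X _ GSmu.
  exact: (is_limit_Erel (Erefl _ Xmu) (inv_lim _ Xmu phi b) (GS_lim _ GSmu phi b)).
split=> //.
  split=> [mu GSmu|mu nu /set_mem GSmu /set_mem GSnu E|_ [a Xa <-]].
  - by exists (abar mu) => //; exact: GS_X.
  - by rewrite -(inv_cls mu GSmu) E inv_cls.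
  - by exists (inv (cls a)); [exact: inv_GS|exact: cls_inv].
exists inv; split=> // [a Xa phi b|_ [a Xa <-]|_ [a Xa <-]].
- by apply: (@rate_cvg _ 2) => //; exact: inv_lim.
- exact: inv_GS.
- exact: cls_inv.
Qed.
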